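(* Let $\mathcal D=(V,E)$ be a directed acyclic graph on $V=\{1,\dots,p\}$ in a parent ordering, $U$ a symmetric positive definite $p\times p$ matrix, and $\alpha\in\mathbb R^p$ with $\alpha_i>pa_i+2$ for all $i$. Let $\Sigma\sim\pi^{\mathrm{PD}_{\mathcal D}}_{U,\alpha}$ and $\Gamma=\Sigma^E$ (so that $\Sigma$ is the completion of $\Gamma$ in $\mathrm{PD}_{\mathcal D}$). Then the density of $\Gamma\sim\pi^{\mathrm S_{\mathcal D}}_{U,\alpha}$ with respect to Lebesgue measure on $\mathrm S_{\mathcal D}$ is $$z_{\mathcal D}(U,\alpha)^{-1}\exp\Big\{-\tfrac12\operatorname{tr}(\Sigma^{-1}U)\Big\}\prod_{i=1}^p\frac{\det(\Sigma_{\preceq i\succeq})^{-\frac12\alpha_i}}{\det(\Sigma_{\prec i\succ})^{-\frac12\alpha_i+1}}.$$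
   Context: Parent ordering: every directed edge $i\to j$ satisfies $i>j$. $E$ contains all loops $(i,i)$, and for $i\neq j$, $(i,j)\in E$ means $i\to j$. $\mathrm{pa}(i)$ is the set of parents of $i$ (excluding $i$), $pa_i=|\mathrm{pa}(i)|$, $\mathrm{fa}(i)=\mathrm{pa}(i)\cup\{i\}$. For a $p\times p$ matrix $A$: $A_{\prec i\succ}$ and $A_{\preceq i\succeq}$ are the principal submatrices indexed by $\mathrm{pa}(i)$ and $\mathrm{fa}(i)$; $A_{\prec i]}=(A_{ji})_{j\in\mathrm{pa}(i)}$, $A_{[i\succ}=(A_{ij})_{j\in\mathrm{pa}(i)}$; $A_{ii\mid\prec i\succ}=A_{ii}-A_{[i\succ}(A_{\prec i\succ})^{-1}A_{\prec i]}$. For an empty parent set, determinants equal one and the associated vectors and quadratic forms are absent. $\mathcal L_{\mathcal D}$: real lower triangular $p\times p$ matrices with unit diagonal and $L_{ij}=0$ for $i\neq j$, $i\notin\mathrm{pa}(j)$. $\Theta_{\mathcal D}$: pairs $(D,L)$ with $D$ diagonal with strictly positive diagonal and $L\in\mathcal L_{\mathcal D}$. The DAG--Wishart distribution $\pi^{\Theta_{\mathcal D}}_{U,\alpha}$ has density $z_{\mathcal D}(U,\alpha)^{-1}\exp\{-\frac12\operatorname{tr}(LD^{-1}L^\top U)\}\prod_iD_{ii}^{-\alpha_i/2}$ with respect to $\prod_idD_{ii}\prod_i\prod_{j\in\mathrm{pa}(i)}dL_{ji}$, where $$z_{\mathcal D}(U,\alpha)=\prod_{i=1}^p2^{\alpha_i/2-1}\pi^{pa_i/2}\Gamma(a_i)\det(U_{\prec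 i\succ})^{-1/2}U_{ii\mid\prec i\succ}^{-a_i},\qquad a_i=\tfrac{\alpha_i-pa_i}2-1.$$ $\mathrm{PD}_{\mathcal D}=\{L^{-\top}DL^{-1}:(D,L)\in\Theta_{\mathcal D}\}$ is the space of covariance matrices, and $\pi^{\mathrm{PD}_{\mathcal D}}_{U,\alpha}$ is the image of $\pi^{\Theta_{\mathcal D}}_{U,\alpha}$ under $(D,L)\mapsto L^{-\top}DL^{-1}$. $\mathrm I_{\mathcal D}\cong\mathbb R^{|E|}$ is the space of $\mathcal D$-incomplete symmetric matrices, with entries specified only on the diagonal and on edges of the undirected version of $\mathcal D$ (one coordinate per element of $E$); $A\mapsto A^E$ is the projection of symmetric matrices onto $\mathrm I_{\mathcal D}$. $\mathrm S_{\mathcal D}=\{\Sigma^E:\Sigma\in\mathrm{PD}_{\mathcal D}\}$, an open subset of $\mathrm I_{\mathcal D}$; each $\Gamma\in\mathrm S_{\mathcal D}$ has a unique completion $\Sigma\in\mathrm{PD}_{\mathcal D}$ with $\Sigma^E=\Gamma$. $\pi^{\mathrm S_{\mathcal D}}_{U,\alpha}$ is the image of $\pi^{\Theta_{\mathcal D}}_{U,\alpha}$ under $(D,L)\mapsto(L^{-\top}DL^{-1})^E$. *)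

(* Defs.v *)
From HB Require Import structures.
From mathcomp Require Import all_boot all_order all_algebra.
From mathcomp Require Import all_classical all_reals all_analysis.

Set Implicit Arguments.
Unset Strict Implicit.
Unset Printing Implicit Defensive.

Import Order.TTheory GRing.Theory Num.Theory.
Import numFieldNormedType.Exports.

Local Open Scope classical_set_scope.
Local Open Scope ring_scope.

(* Matrices carry the smallest sigma-algebra making every entry measurable
   (the Borel sigma-algebra of R^(m * n)). *)
Section matrix_measurable.
Context (R : realType) (m n : nat).

Let entries (i : 'I_m * 'I_n) (A : 'M[R]_(m, n)) : R := A i.1 i.2.

Definition matrix_measurable : set (set 'M[R]_(m, n)) :=
  <<s [set B | exists i, exists2 Y : set R, measurable Y & B = entries i @^-1` Y] >>.

Let matrix_measurable0 : matrix_measurable set0.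
Proof. exact: sigma_algebra0. Qed.

Let matrix_measurableC A :
  matrix_measurable A -> matrix_measurable (~` A).
Proof. exact: sigma_algebraC. Qed.

Let matrix_measurable_bigcup (F : (set 'M[R]_(m, n))^nat) :
  (forall i, matrix_measurable (F i)) -> matrix_measurable (\bigcup_i F i).
Proof. exact: sigma_algebra_bigcup. Qed.

HB.instance Definition _ := @isMeasurable.Build default_measure_display
  'M[R]_(m, n) matrix_measurable
  matrix_measurable0 matrix_measurableC matrix_measurable_bigcup.

End matrix_measurable.

(* Lebesgue measure on R^n, as the n-fold product of the one on R. *)
Section lebesgue_tuple.
Context (R : realType).

Definition cons_tuple m (xt : measurableTypeR R * m.-tuple R) : m.+1.-tuple R :=
  [tuple of (xt.1 : R) :: xt.2].

Fixpoint lebesgue_tuple (n : nat) : set (n.-tuple R) -> \bar R :=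
  match n with
  | 0 => dirac [tuple]
  | m.+1 => pushforward (lebesgue_measure \x @lebesgue_tuple m)%E
              (@cons_tuple m)
  end.

Lemma measurable_cons_tuple m : measurable_fun setT (@cons_tuple m).
Proof.
apply: measurable_cons; last exact: measurable_snd.
exact: (@measurable_fst _ _ (measurableTypeR R) (m.-tuple R)).
Qed.

Section step.
Context (m : nat) (mu : {sigma_finite_measure set (m.-tuple R) -> \bar R}).

Let nu : set (m.+1.-tuple R) -> \bar R :=
  pushforward (lebesgue_measure \x mu)%E (@cons_tuple m).

Let nu0 : nu set0 = 0%E.
Proof. by rewrite /nu /pushforward preimage_set0 measure0. Qed.

Let nu_ge0 A : (0 <= nu A)%E.
Proof. by rewrite /nu /pushforward; exact: measure_ge0. Qed.

Let nu_sigma_additive : semi_sigma_additive nu.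
Proof.
pose f := @cons_tuple m.
have mf A : measurable A -> measurable (f @^-1` A).
  by move=> mA; rewrite -[X in measurable X]setTI; exact: measurable_cons_tuple.
move=> F mF tF mUF; rewrite /nu /pushforward preimage_bigcup.
apply: measure_semi_sigma_additive.
- by move=> n; exact: mf.
- apply/trivIsetP => /= i j _ _ ij; rewrite -preimage_setI.
  by move/trivIsetP : tF => /(_ _ _ _ _ ij) ->//; rewrite preimage_set0.
- by rewrite -preimage_bigcup; exact: mf.
Qed.

HB.instance Definition _ := isMeasure.Build _ _ _ nu
  nu0 nu_ge0 nu_sigma_additive.

Let product_sigma_finite : sigma_finite setT (@lebesgue_measure R \x mu)%E.
Proof.
have /sigma_finiteP[F [TF ndF Foo]] := sigma_finiteT (@lebesgue_measure R).
have /sigma_finiteP[G [TG ndG Goo]] := sigma_finiteT mu.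
exists (fun n => F n `*` G n) => [|k].
  rewrite -setXTT TF TG predeqE => -[x y]; split.
    move=> [/= [n _ Fnx] [k _ Gky]]; exists (maxn n k) => //; split.
    - by move: x Fnx; exact/subsetPset/ndF/leq_maxl.
    - by move: y Gky; exact/subsetPset/ndG/leq_maxr.
  by move=> [n _ []/= ? ?]; split; exists n.
have [? ?] := Foo k; have [? ?] := Goo k; split; first exact: measurableX.
rewrite product_measure1E// lte_mul_pinfty//.
by rewrite ge0_fin_numE//; exact: measure_ge0.
Qed.

Let nu_sigma_finite : sigma_finite setT nu.
Proof.
have [F FT Foo] := product_sigma_finite.
pose g (t : m.+1.-tuple R) : measurableTypeR R * m.-tuple R :=
  (thead t, [tuple of behead t]).
have gK : cancel (@cons_tuple m) g.
  by move=> [x t]; rewrite /g /cons_tuple theadE; congr pair; exact/val_inj.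
have mg : measurable_fun setT g.
  apply/measurable_fun_pairP; split.
    exact: (@measurable_tnth _ R m.+1 ord0).
  exact: measurable_behead.
exists (fun n => g @^-1` F n) => [|n]; first by rewrite -preimage_bigcup -FT.
have [mFn Fnoo] := Foo n; split.
  by rewrite -[X in measurable X]setTI; exact: mg.
by rewrite /nu /pushforward -comp_preimage (_ : g \o _ = id)//; exact/funext.
Qed.

HB.instance Definition _ := Measure_isSigmaFinite.Build _ _ _ nu nu_sigma_finite.

Lemma lebesgue_tuple_step :
  exists nu' : {sigma_finite_measure set (m.+1.-tuple R) -> \bar R},
    pushforward (lebesgue_measure \x mu)%E (@cons_tuple m) = nu'.
Proof. by exists nu. Qed.

End step.

Let lebesgue_tuple_ind n :
  exists mu : {sigma_finite_measure set (n.-tuple R) -> \bar R},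
    @lebesgue_tuple n = mu.
Proof.
elim: n => [|n [mu IH]] /=.
  by exists (dirac [tuple] : {sigma_finite_measure set _ -> \bar R}).
by rewrite IH; exact: lebesgue_tuple_step.
Qed.

Let lebesgue_tuple0 n : @lebesgue_tuple n set0 = 0%E.
Proof. by have [mu ->] := lebesgue_tuple_ind n; exact: measure0. Qed.

Let lebesgue_tuple_ge0 n A : (0 <= @lebesgue_tuple n A)%E.
Proof. by have [mu ->] := lebesgue_tuple_ind n; exact: measure_ge0. Qed.

Let lebesgue_tuple_sigma_additive n : semi_sigma_additive (@lebesgue_tuple n).
Proof.
by have [mu ->] := lebesgue_tuple_ind n; exact: measure_semi_sigma_additive.
Qed.

HB.instance Definition _ n := isMeasure.Build _ _ _ (@lebesgue_tuple n)
  (lebesgue_tuple0 n) (@lebesgue_tuple_ge0 n)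
  (@lebesgue_tuple_sigma_additive n).

Let lebesgue_tuple_sigma_finite n : sigma_finite setT (@lebesgue_tuple n).
Proof. by have [mu ->] := lebesgue_tuple_ind n; exact: sigma_finiteT. Qed.

HB.instance Definition _ n := Measure_isSigmaFinite.Build _ _ _
  (@lebesgue_tuple n) (@lebesgue_tuple_sigma_finite n).

End lebesgue_tuple.
Arguments lebesgue_tuple : clear implicits.

(* [nu] is a measure on the ambient space, so the last clause also says that it
   does not charge the complement of [S]. *)
Definition has_density d (T : measurableType d) (R : realType)
    (mu nu : set T -> \bar R) (S : set T) (f : T -> R) : Prop :=
  [/\ measurable S, measurable_fun S f, forall x, S x -> 0 <= f x &
      forall A, measurable A -> nu A = (\int[mu]_(x in A `&` S) (f x)%:E)%E].

Section graph.
Context (p : nat).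
Implicit Type E : {set 'I_p * 'I_p}.

(* [E] contains the loops; for [i != j], [(i, j) \in E] is the edge i -> j.
   Acyclicity follows from the ordering of the edges. *)
Definition parent_ordered_dag E : Prop :=
  (forall i, (i, i) \in E) /\
  (forall i j, (i, j) \in E -> i != j -> (j < i)%N).

Definition pa E (i : 'I_p) : {set 'I_p} := [set j | ((j, i) \in E) && (j != i)].

Definition fa E (i : 'I_p) : {set 'I_p} := i |: pa E i.

End graph.

Section matrices.
Context (R : realType) (p : nat).
Implicit Types (A : 'M[R]_p) (E : {set 'I_p * 'I_p}).

Definition principal_submx (B : {set 'I_p}) A : 'M[R]_#|B| :=
  mxsub (@enum_val _ (mem B)) (@enum_val _ (mem B)) A.

Definition schur_pa E A (i : 'I_p) : R :=
  let r := \row_(k < #|pa E i|) A i (enum_val k) in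
  let c := \col_(k < #|pa E i|) A (enum_val k) i in
  A i i - (r *m invmx (principal_submx (pa E i) A) *m c) 0 0.

Definition posdefmx A : Prop :=
  A^T = A /\ forall v : 'cV[R]_p, v != 0 -> 0 < (v^T *m A *m v) 0 0.

Definition cholesky_space E (L : 'M[R]_p) : Prop :=
  [/\ is_trig_mx L, forall i, L i i = 1 &
      forall i j, i != j -> i \notin pa E j -> L i j = 0].

Definition Theta E : set ('M[R]_p * 'M[R]_p) :=
  [set DL | [/\ is_diag_mx DL.1, forall i, 0 < DL.1 i i &
                cholesky_space E DL.2]].

Definition covariance (DL : 'M[R]_p * 'M[R]_p) : 'M[R]_p :=
  (invmx DL.2)^T *m DL.1 *m invmx DL.2.

Definition PD E : set 'M[R]_p := covariance @` Theta E.

(* D-incomplete symmetric matrices have one coordinate per element of [E] and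
   are represented by tuples of length [#|E|], in the order of [enum E]. *)
Definition incomplete E A : #|E|.-tuple R :=
  [tuple A (enum_val k).1 (enum_val k).2 | k < #|E|].

Definition edge_coord E (t : #|E|.-tuple R) (e : 'I_p * 'I_p) : R :=
  nth 0 t (index e (enum E)).

Definition S_D E : set (#|E|.-tuple R) := incomplete E @` PD E.

(* The element of [PD E] with the prescribed entries (unique when the argument
   lies in [S_D E]). *)
Definition completion E (t : #|E|.-tuple R) : 'M[R]_p :=
  xget 0 [set A | PD E A /\ incomplete E A = t].

(* The coordinates of [Theta E] are the D_ii, indexed by the loops, and the
   L_ji for j a parent of i, indexed by the edges (j, i). *)
Definition theta_of_coord E (t : #|E|.-tuple R) : 'M[R]_p * 'M[R]_p :=
  (\matrix_(i, j) if i == j then edge_coord t (i, i) else 0,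
   \matrix_(i, j) if i == j then 1
                  else if (i, j) \in E then edge_coord t (i, j) else 0).

End matrices.

Section dag_wishart.
Context (R : realType) (p : nat) (E : {set 'I_p * 'I_p}).
Implicit Types (U : 'M[R]_p) (alpha : 'I_p -> R).

Definition Gamma_fun (a : R) : R :=
  \int[lebesgue_measure]_(x in `]0, +oo[) (x `^ (a - 1) * expR (- x)).

Definition dw_shape alpha (i : 'I_p) : R := (alpha i - #|pa E i|%:R) / 2 - 1.

Definition dw_z U alpha : R :=
  \prod_(i < p)
    (2 `^ (alpha i / 2 - 1) * pi `^ (#|pa E i|%:R / 2)
     * Gamma_fun (dw_shape alpha i)
     * \det (principal_submx (pa E i) U) `^ (- (1 / 2))
     * schur_pa E U i `^ (- dw_shape alpha i)).

Definition dw_theta_density U alpha (DL : 'M[R]_p * 'M[R]_p) : R :=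
  (dw_z U alpha)^-1
  * expR (- (1 / 2) * \tr (DL.2 *m invmx DL.1 *m DL.2^T *m U))
  * \prod_(i < p) DL.1 i i `^ (- (alpha i / 2)).

(* The reference measure on [Theta E], the product of the dD_ii and the dL_ji,
   is Lebesgue measure in the coordinates [theta_of_coord]. *)
Definition dw_theta U alpha (B : set ('M[R]_p * 'M[R]_p)) : \bar R :=
  (\int[lebesgue_tuple R #|E|]_(t in @theta_of_coord R p E @^-1` (B `&` Theta E))
     (dw_theta_density U alpha (theta_of_coord t))%:E)%E.

Definition dw_PD U alpha : set 'M[R]_p -> \bar R :=
  pushforward (dw_theta U alpha) (@covariance R p).

Definition dw_S U alpha : set (#|E|.-tuple R) -> \bar R :=
  pushforward (dw_theta U alpha) (incomplete E \o @covariance R p).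

End dag_wishart.
Arguments S_D R {p} E.
Arguments dw_S {R p} E U alpha.

(* Main.v *)
Require Import Defs.
From HB Require Import structures.
From mathcomp Require Import all_boot all_order all_algebra.
From mathcomp Require Import all_classical all_reals all_analysis.
From mathcomp Require Import perm measurable_realfun ring zify.

Import Order.TTheory GRing.Theory Num.Theory.
Import numFieldNormedType.Exports.

Local Open Scope classical_set_scope.
Local Open Scope ring_scope.

(** Write X for the matrix that stores a parameter (D, L): D on the diagonal
    and L off it.  If L^T x = e with e ~ N(0, D), then vertex i is regressed on
    its parents with coefficients minus the i-th column of L and residual
    variance D_ii, so for Sigma = L^-T D L^-1
    [[
       Sigma_(pa i, i) = - Sigma_(pa i) X_(pa i, i),
       Sigma_ii = X_ii - X_(pa i, i)^T Sigma_(pa i, i)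
    ]]
    ([pa_col_regression], [diag_regression]).  Parents have larger labels, and
    the entries of Sigma at labels > i only involve the columns > i of X
    ([cov_local]).  Hence (D, L) -> Sigma^E is block triangular when the
    coordinates are grouped by columns and the columns are taken from the last
    to the first.  Solving the two equations for column i of X gives an inverse
    [theta_inv], defined and measurable on all matrices; Gamma belongs to S_D
    exactly when its image by [theta_inv] has a positive diagonal ([S_DP]), and
    its completion is then the covariance matrix of this image
    ([completionE]).

    With the columns > i fixed, the i-th block of the map is the composite of
    the linear map - Sigma_(pa i) on the off-diagonal coordinates and of a shear
    of the diagonal one, so its Jacobian is det Sigma_(pa i).  Tonelli's theorem
    lets the Lebesgue integral over R^E be computed column by column, and an
    induction over the columns ([marginal_change]) shows that the density of
    Gamma is the density of (D, L) times the product of the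
    det Sigma_(pa i)^-1.  The stated formula follows from
    Sigma^-1 = L D^-1 L^T and D_ii = det Sigma_(fa i) / det Sigma_(pa i)
    ([density_change]).

    The analytic input is thus the linear change of variables
    ([integral_linear]), for matrices whose quadratic form has no nontrivial
    zero.  It is obtained by eliminating one variable at a time: an affine
    substitution on the line, then the Schur complement.

    The statement on random matrices amounts to the uniqueness of the
    completion ([completion_incomplete]) and to the compatibility of image
    measures with composition. *)

Set Implicit Arguments.
Unset Strict Implicit.
Unset Printing Implicit Defensive.

(** * Affine substitutions on the real line *)

Section affine_real.
Context (R : realType).
Local Notation leb := (@lebesgue_measure R).

Definition affine (a b : R) (x : measurableTypeR R) : measurableTypeR R :=
  a * x + b.

Lemma measurable_affine a b : measurable_fun setT (affine a b).
Proof. exact: (@measurable_funD _ (measurableTypeR R)). Qed.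

Let image_measure a b : {measure set (measurableTypeR R) -> \bar R} :=
  measure_function_pushforward__canonical__measure_function_Measure
    leb (measurable_affine a b).

(** Lebesgue measure is determined by its values on half-open intervals.  For
    negative [a] the preimage of such an interval is closed on the other side,
    which does not change its length. *)
Lemma lebesgue_measure_affine (a b : R) (A : set (measurableTypeR R)) :
  a != 0 -> measurable A ->
  (`|a|%:E * leb (affine a b @^-1` A) = leb A)%E.
Proof.
move=> a0 mA.
have a_ge0 : 0 <= `|a| by [].
pose mu : {measure set (measurableTypeR R) -> \bar R} :=
  mscale (NngNum a_ge0) (image_measure a b).
transitivity (mu A) => //.
apply/esym/lebesgue_measure_unique => // _ [[c d]] _ <-.
rewrite /mu /= /mscale /= /pushforward.
have [a_gt0|a_lt0|/eqP] := ltrgt0P a; last by rewrite (negbTE a0).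
- have -> : affine a b @^-1` `]c, d] = `](c - b) / a, (d - b) / a]%classic.
    apply/seteqP; split=> x /=; rewrite /affine !in_itv /=;
    by rewrite ltr_pdivrMr// ler_pdivlMr// ltrBlDr lerBrDr [x * a]mulrC.
  rewrite !lebesgue_measure_itv /= !lte_fin ltr_pM2r ?invr_gt0// ltrD2r.
  case: ifPn => cd; last by rewrite mule0.
  by rewrite -!EFinD -EFinM; congr _%:E; field.
- have -> : affine a b @^-1` `]c, d] = `[(d - b) / a, (c - b) / a[%classic.
    apply/seteqP; split=> x /=; rewrite /affine !in_itv /=;
    rewrite ler_ndivrMr// ltr_ndivlMr// ltrBlDr lerBrDr [x * a]mulrC;
    by rewrite andbC.
  rewrite !lebesgue_measure_itv /= !lte_fin ltr_nM2r ?invr_lt0// ltrD2r.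
  case: ifPn => cd; last by rewrite mule0.
  by rewrite -!EFinD -EFinM; congr _%:E; field.
Qed.

Lemma integral_affine (a b : R) (F : R -> \bar R) : a != 0 ->
  measurable_fun setT F -> (forall x, 0 <= F x)%E ->
  (`|a|%:E * \int[leb]_x F (a * x + b)%R = \int[leb]_x F x)%E.
Proof.
move=> a0 mF F0.
have a_ge0 : 0 <= `|a| by [].
rewrite [X in (_ * X)%E](_ : _ =
    (\int[image_measure a b]_x F x)%E); last first.
  by rewrite /= ge0_integral_pushforward//; exact: measurable_affine.
rewrite -(@ge0_integral_mscale _ _ _ (image_measure a b) setT _ (NngNum a_ge0))//.
apply: eq_measure_integral => A mA _.
exact: lebesgue_measure_affine.
Qed.

End affine_real.

(** * Measurability of matrix-valued functions *)

Section matrix_measurability.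
Context (R : realType) d (T : measurableType d) (m n : nat).

Lemma measurable_entry (i : 'I_m) (j : 'I_n) :
  measurable_fun setT (fun A : 'M[R]_(m, n) => A i j).
Proof.
move=> _ Y mY; rewrite setTI; apply: sub_sigma_algebra.
by exists (i, j), Y.
Qed.

Lemma measurable_matrixP (f : T -> 'M[R]_(m, n)) :
  measurable_fun setT f <-> forall i j, measurable_fun setT (fun x => f x i j).
Proof.
split=> [mf i j|mf].
  exact: (measurableT_comp (measurable_entry i j) mf).
apply: (@measurability _ _ _ _ _ _
  [set B | exists k, exists2 Y : set R, measurable Y &
     B = (fun A : 'M[R]_(m, n) => A k.1 k.2) @^-1` Y]) => //.
move=> _ [_ [[i j] [Y mY ->]] <-].
exact: (mf i j).
Qed.

End matrix_measurability.

Section matrix_operations.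
Context (R : realType) d (T : measurableType d).

Lemma measurable_mulmx m n q (f : T -> 'M[R]_(m, n)) (g : T -> 'M[R]_(n, q)) :
  measurable_fun setT f -> measurable_fun setT g ->
  measurable_fun setT (fun x => f x *m g x).
Proof.
move=> /measurable_matrixP mf /measurable_matrixP mg.
apply/measurable_matrixP => i j; under eq_fun do rewrite mxE.
by apply: measurable_sum => k; exact: measurable_funM.
Qed.

Lemma measurable_addmx m n (f g : T -> 'M[R]_(m, n)) :
  measurable_fun setT f -> measurable_fun setT g ->
  measurable_fun setT (fun x => f x + g x).
Proof.
move=> /measurable_matrixP mf /measurable_matrixP mg.
apply/measurable_matrixP => i j; under eq_fun do rewrite mxE.
exact: measurable_funD.
Qed.

Lemma measurable_scalar_mx n (f : T -> R) :
  measurable_fun setT f ->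
  measurable_fun setT (fun x => (f x)%:M : 'M[R]_n).
Proof.
move=> mf; apply/measurable_matrixP => i j; under eq_fun do rewrite mxE.
case: (i == j) => /=; first by under eq_fun do rewrite mulr1n; exact: mf.
under eq_fun do rewrite mulr0n.
exact: measurable_cst.
Qed.

Lemma measurable_col_mx m1 m2 n (f : T -> 'M[R]_(m1, n))
    (g : T -> 'M[R]_(m2, n)) :
  measurable_fun setT f -> measurable_fun setT g ->
  measurable_fun setT (fun x => col_mx (f x) (g x)).
Proof.
move=> /measurable_matrixP mf /measurable_matrixP mg.
apply/measurable_matrixP => i j.
rewrite -[i]fintype.splitK; case: (fintype.split i) => k /=.
  by under eq_fun do rewrite col_mxEu; exact: mf.
by under eq_fun do rewrite col_mxEd; exact: mg.
Qed.

End matrix_operations.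

(** * Integration over tuples by Tonelli's theorem *)

Section lebesgue_tuple_theory.
Context (R : realType).
Local Notation leb := (@lebesgue_measure R).
Local Open Scope ereal_scope.

Definition col_tuple n (t : n.-tuple R) : 'cV[R]_n := \col_i tnth t i.

Lemma measurable_col_tuple n : measurable_fun setT (@col_tuple n).
Proof.
apply/measurable_matrixP => i j.
under eq_fun do rewrite mxE.
exact: measurable_tnth.
Qed.

Lemma col_tuple_cons n (x : R) (t : n.-tuple R) :
  col_tuple (Defs.cons_tuple (x, t)) = col_mx x%:M (col_tuple t) :> 'cV_(1 + n).
Proof.
apply/matrixP => i j; rewrite ord1 -[i]fintype.splitK; case: (fintype.split i) => k /=.
  by rewrite ord1 col_mxEu !mxE (tnth_nth x).
by rewrite col_mxEd !mxE !(tnth_nth x).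
Qed.

Lemma integral_lebesgue_tuple0 (F : 0.-tuple R -> \bar R) :
  \int[lebesgue_tuple R 0]_t F t = F [tuple].
Proof.
rewrite /= integral_dirac//; first by rewrite diracT mul1e.
move=> _ Y mY.
have [h|h] := pselect (Y (F [tuple])).
  rewrite (_ : _ `&` _ = setT); first exact: measurableT.
  by apply/seteqP; split=> // t _; rewrite (tuple0 t); split.
rewrite (_ : _ `&` _ = set0); first exact: measurable0.
by apply/seteqP; split=> // t [_]; rewrite /= (tuple0 t).
Qed.

Section step.
Context (n : nat) (F : n.+1.-tuple R -> \bar R).
Hypotheses (mF : measurable_fun setT F) (F0 : forall t, 0 <= F t).

Let mFc : measurable_fun setT (F \o @Defs.cons_tuple R n).
Proof. exact: (measurableT_comp mF (@measurable_cons_tuple R n)). Qed.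

Let push : \int[lebesgue_tuple R n.+1]_t F t =
  \int[leb \x lebesgue_tuple R n]_z F (Defs.cons_tuple z).
Proof.
by rewrite /= (ge0_integral_pushforward (@measurable_cons_tuple R n)).
Qed.

Lemma integral_lebesgue_tupleS : \int[lebesgue_tuple R n.+1]_t F t =
  \int[leb]_x \int[lebesgue_tuple R n]_t F (Defs.cons_tuple (x, t)).
Proof. by rewrite push (fubini_tonelli1 _ mFc (fun=> F0 _)). Qed.

Lemma integral_lebesgue_tupleSr : \int[lebesgue_tuple R n.+1]_t F t =
  \int[lebesgue_tuple R n]_t \int[leb]_x F (Defs.cons_tuple (x, t)).
Proof. by rewrite push (fubini_tonelli2 _ mFc (fun=> F0 _)). Qed.

End step.

End lebesgue_tuple_theory.

(** * Linear changes of variables *)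

Section linear_change_of_variables.
Context (R : realType).
Local Notation leb := (@lebesgue_measure R).

(** This class of matrices makes elimination work without exchanging rows: it
    forces a nonzero pivot, and it passes to Schur complements and to
    opposites. *)
Definition anisotropic n (A : 'M[R]_n) : Prop :=
  forall v : 'cV_n, v != 0 -> (v^T *m A *m v) 0 0 != 0.

Let pivot_vector m : 'cV[R]_(1 + m) := col_mx 1%:M 0.

Let pivot_vector_neq0 m : pivot_vector m != 0.
Proof.
apply/eqP => /matrixP /(_ (lshift _ 0) 0) /eqP.
by rewrite col_mxEu !mxE eqxx oner_eq0.
Qed.

Let pivot_form m (A : 'M[R]_(1 + m)) :
  (pivot_vector m)^T *m A *m pivot_vector m = ulsubmx A.
Proof.
rewrite /pivot_vector -{1}[A]submxK tr_col_mx mul_row_block mul_row_col.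
by rewrite trmx0 !mul0mx !mulmx0 !addr0 trmx1 mul1mx mulmx1.
Qed.

Lemma anisotropic_pivot m (A : 'M[R]_(1 + m)) :
  anisotropic A -> ulsubmx A 0 0 != 0.
Proof. by move=> /(_ _ (pivot_vector_neq0 m)); rewrite pivot_form. Qed.

Definition schur_block m (A : 'M[R]_(1 + m)) : 'M[R]_m :=
  drsubmx A - (ulsubmx A 0 0)^-1 *: (dlsubmx A *m ursubmx A).

(** Block Gaussian elimination of the first column. *)
Lemma det_schur_block m (A : 'M[R]_(1 + m)) : ulsubmx A 0 0 != 0 ->
  \det A = ulsubmx A 0 0 * \det (schur_block A).
Proof.
set a := ulsubmx A 0 0 => a0.
have AE : A = block_mx 1%:M 0 (a^-1 *: dlsubmx A) 1%:M *m
              block_mx (ulsubmx A) (ursubmx A) 0 (schur_block A).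
  rewrite mulmx_block !mul1mx !mul0mx !addr0.
  rewrite [ulsubmx A]mx11_scalar -/a -scalemxAl mul_mx_scalar.
  rewrite scalerA mulVf// scale1r /schur_block -/a -scalemxAl addrC subrK.
  by rewrite -mx11_scalar submxK.
rewrite {1}AE det_mulmx det_lblock det_ublock !det1 !mul1r.
by rewrite {1}[ulsubmx A]mx11_scalar det_scalar1.
Qed.

(** The first coordinate of [u] is chosen so as to annihilate that of [A u];
    hence the form of the Schur complement is the form of [A] on a subspace. *)
Lemma schur_block_form m (A : 'M[R]_(1 + m)) (v : 'cV[R]_m) :
  ulsubmx A 0 0 != 0 ->
  let u := col_mx (- (ulsubmx A 0 0)^-1 *: (ursubmx A *m v)) v in
  u^T *m A *m u = v^T *m schur_block A *m v.
Proof.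
set a := ulsubmx A 0 0 => a0 /=.
rewrite -mulmxA -{2}[A]submxK mul_block_col.
rewrite [ulsubmx A]mx11_scalar -/a mul_scalar_mx scalerA mulrN mulfV// scaleN1r.
rewrite addNr tr_col_mx mul_row_col mulmx0 add0r.
rewrite /schur_block -/a -[RHS]mulmxA mulmxBl -scalemxAr -scalemxAl mulmxA.
by rewrite scaleNr addrC.
Qed.

Lemma anisotropic_schur m (A : 'M[R]_(1 + m)) :
  anisotropic A -> anisotropic (schur_block A).
Proof.
move=> aniA v v0; rewrite -(schur_block_form v (anisotropic_pivot aniA)).
by apply: aniA; apply: contra_neq v0 => /(congr1 dsubmx); rewrite col_mxKd linear0.
Qed.

Definition positive_form n (A : 'M[R]_n) : Prop :=
  forall v : 'cV_n, v != 0 -> 0 < (v^T *m A *m v) 0 0.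

Lemma positive_anisotropic n (A : 'M[R]_n) : positive_form A -> anisotropic A.
Proof. by move=> pA v /pA /lt0r_neq0. Qed.

Lemma anisotropicN n (A : 'M[R]_n) : anisotropic A -> anisotropic (- A).
Proof. by move=> aA v /aA vAv; rewrite mulmxN mulNmx mxE oppr_eq0. Qed.

Lemma positive_det n (A : 'M[R]_n) : positive_form A -> 0 < \det A.
Proof.
elim: n A => [A _|n IH]; first by rewrite det_mx00.
rewrite -[n.+1]/(1 + n)%N => A pA.
have a0 := anisotropic_pivot (positive_anisotropic pA).
rewrite (det_schur_block a0) mulr_gt0//.
  by have /pA := pivot_vector_neq0 n; rewrite pivot_form.
apply: IH => v v0; rewrite -(schur_block_form v a0); apply: pA.
by apply: contra_neq v0 => /(congr1 dsubmx); rewrite col_mxKd linear0.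
Qed.

(** For fixed last coordinates [y], the first coordinate of [A t + b] is an
    affine function of the first coordinate [x] of [t], with slope the pivot.
    After substituting this coordinate [z] for [x] and exchanging the order of
    integration, the remaining coordinates are the image of [y] by an affine
    map whose linear part is the Schur complement.  The offset [b] is there to
    absorb the terms in [z], which are constant for the inner integral. *)
Lemma integral_linear n (A : 'M[R]_n) (b : 'cV[R]_n) (F : 'cV[R]_n -> \bar R) :
  anisotropic A -> measurable_fun setT F -> (forall v, 0 <= F v)%E ->
  (`|\det A|%:E * \int[lebesgue_tuple R n]_t F (A *m col_tuple t + b)%R
   = \int[lebesgue_tuple R n]_t F (col_tuple t))%E.
Proof.
elim: n A b F => [|n IH] A b F aniA mF F0.
  rewrite det_mx00 normr1 mul1e; apply: eq_integral => t _; congr F.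
  by apply/matrixP => -[].
move: A b F aniA mF F0; rewrite -[n.+1]/(1 + n)%N => A b F aniA mF F0.
have a0 := anisotropic_pivot aniA; set a := ulsubmx A 0 0 in a0.
rewrite (det_schur_block a0) -/a normrM.
(* [G z y] is the integrand in terms of the new first coordinate [z]. *)
pose c := a^-1 *: dlsubmx A.
pose G (z : R) (y : 'cV[R]_n) : \bar R :=
  F (col_mx z%:M (schur_block A *m y + (c *m (z%:M - usubmx b) + dsubmx b))).
pose s (y : 'cV[R]_n) : R := (ursubmx A *m y + usubmx b) 0 0.
have FE x y : F (A *m col_mx x%:M y + b) = G (a * x + s y) y.
  rewrite /G; congr F; rewrite -{1}[A]submxK mul_block_col -{1}[b]vsubmxK.
  rewrite add_col_mx.
  have scal : ulsubmx A *m x%:M + ursubmx A *m y + usubmx b = (a * x + s y)%:M.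
    rewrite -addrA [X in _ + X = _]mx11_scalar {1}[ulsubmx A]mx11_scalar.
    by rewrite mul_scalar_mx scale_scalar_mx -raddfD.
  rewrite scal; congr col_mx; rewrite -scal /schur_block mulmxBl addrA.
  congr (_ + _); rewrite -/a addrK mulmxDr [ulsubmx A]mx11_scalar -/a.
  rewrite mul_scalar_mx -scalemxAr -!scalemxAl scalerA mulfV// scale1r.
  by rewrite mulmxA [RHS]addrACA addNr addr0 addrC.
have mG : measurable_fun setT (fun z : R * n.-tuple R => G z.1 (col_tuple z.2)).
  have mt : measurable_fun setT (fun z : R * n.-tuple R => col_tuple z.2).
    exact: (measurableT_comp (@measurable_col_tuple R n)).
  apply: (measurableT_comp mF); apply: measurable_col_mx.
    exact: measurable_scalar_mx.
  apply: measurable_addmx; first exact: measurable_mulmx.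
  apply: measurable_addmx => //; apply: measurable_mulmx => //.
  by apply: measurable_addmx => //; exact: measurable_scalar_mx.
have G0 z y : (0 <= G z y)%E by exact: F0.
have mGx y : measurable_fun setT (G^~ (col_tuple y)).
  exact: (measurableT_comp mG (pair2_measurable y)).
have mFt : measurable_fun setT
    (fun t : n.+1.-tuple R => F (A *m col_tuple t + b)).
  apply: (measurableT_comp mF); apply: measurable_addmx => //.
  by apply: measurable_mulmx => //; exact: measurable_col_tuple.
rewrite (integral_lebesgue_tupleSr mFt) => [|t]; last exact: F0.
rewrite (@integral_lebesgue_tupleS R n (F \o @col_tuple R n.+1)); last 2 first.
- exact: (measurableT_comp mF (@measurable_col_tuple R n.+1)).
- by move=> t; exact: F0.
under eq_integral do under eq_integral do rewrite col_tuple_cons FE.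
have mGs : measurable_fun setT
    (fun z : measurableTypeR R * n.-tuple R =>
       G (a * (z.1 : R) + s (col_tuple z.2)) (col_tuple z.2)).
  under eq_fun do rewrite -FE.
  apply: (measurableT_comp mF); apply: measurable_addmx => //.
  apply: measurable_mulmx => //; apply: measurable_col_mx.
    by apply: measurable_scalar_mx; exact: measurable_fst.
  exact: (measurableT_comp (@measurable_col_tuple R n)).
rewrite mulrC EFinM -muleA -ge0_integralZl//; last 2 first.
- exact: (@measurable_fun_fubini_tonelli_G _ _ _ _ _ leb _ mGs (fun=> G0 _ _)).
- by move=> y _; apply: integral_ge0.
under eq_integral do rewrite (integral_affine _ a0 (mGx _) (fun=> G0 _ _)).
rewrite -(@fubini_tonelli _ _ (measurableTypeR R) _ _ leb (lebesgue_tuple R n)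
  (fun z : measurableTypeR R * n.-tuple R => G (z.1 : R) (col_tuple z.2)))//=.
rewrite -ge0_integralZl//; last 2 first.
- exact: (@measurable_fun_fubini_tonelli_F _ _ _ _ _ (lebesgue_tuple R n) _ mG
    (fun=> G0 _ _)).
- by move=> x _; apply: integral_ge0.
apply: eq_integral => x _.
rewrite (IH _ _ (fun y => F (col_mx x%:M y)))//.
- by apply: eq_integral => t _; rewrite col_tuple_cons.
- exact: anisotropic_schur.
- by apply: (measurableT_comp mF); apply: measurable_col_mx.
Qed.

End linear_change_of_variables.

(** * Partial integration over selected matrix entries *)

Section partial_integrals.
Context (R : realType) (m n : nat).
Local Notation leb := (@lebesgue_measure R).
Local Open Scope ereal_scope.
Implicit Types (e : 'I_m * 'I_n) (s : seq ('I_m * 'I_n)) (M N : 'M[R]_(m, n)).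
Implicit Types F G : 'M[R]_(m, n) -> \bar R.

Definition set_entry e (x : R) M : 'M[R]_(m, n) :=
  \matrix_(i, j) if (i, j) == e then x else M i j.

(** For [t] not longer than [s], the entries not listed in [s] keep their
    value: [index] is then [size s] and [nth] returns its default. *)
Definition set_entries s (t : seq R) M : 'M[R]_(m, n) :=
  \matrix_(i, j) nth (M i j) t (index (i, j) s).

(** Keeping the whole matrix as argument, including the entries that are
    integrated out, makes iterated integrals compose by concatenation of index
    lists and their order easy to exchange. *)
Fixpoint marginal s F M : \bar R :=
  if s is e :: s' then \int[leb]_x marginal s' F (set_entry e x M) else F M.

Lemma set_entryC e e' x x' M : e != e' ->
  set_entry e x (set_entry e' x' M) = set_entry e' x' (set_entry e x M).
Proof.
move=> ee'; apply/matrixP => i j; rewrite !mxE.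
have [->|//] := eqVneq (i, j) e; by rewrite (negbTE ee').
Qed.

Lemma set_entries_cons e s x t M : e \notin s -> size t = size s ->
  set_entries (e :: s) (x :: t) M = set_entries s t (set_entry e x M).
Proof.
move=> es ts; apply/matrixP => i j; rewrite !mxE /= eq_sym.
have [->|//] := eqVneq (i, j) e.
by rewrite /= nth_default// memNindex// ts.
Qed.

Lemma measurable_set_entry d (T : measurableType d) e (f : T -> R)
    (g : T -> 'M[R]_(m, n)) :
  measurable_fun setT f -> measurable_fun setT g ->
  measurable_fun setT (fun x => set_entry e (f x) (g x)).
Proof.
move=> mf /measurable_matrixP mg.
apply/measurable_matrixP => i j; under eq_fun do rewrite mxE.
by case: ((i, j) == e); [exact: mf|exact: mg].
Qed.

Lemma measurable_set_entries k s M :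
  measurable_fun setT (fun t : k.-tuple R => set_entries s t M).
Proof.
apply/measurable_matrixP => i j; under eq_fun do rewrite mxE.
have [lek|gek] := ltnP (index (i, j) s) k.
  under eq_fun => t do rewrite -(tnth_nth (M i j) t (Ordinal lek)).
  exact: measurable_tnth.
under eq_fun => t do rewrite nth_default ?size_tuple//.
exact: measurable_cst.
Qed.

Lemma marginal_cat s1 s2 F M :
  marginal (s1 ++ s2) F M = marginal s1 (marginal s2 F) M.
Proof.
elim: s1 M => //= e s IH M.
by under eq_integral do rewrite IH.
Qed.

Lemma marginal_ge0 s F M : (forall N, 0 <= F N) -> 0 <= marginal s F M.
Proof.
by move=> F0; elim: s M => //= e s IH M; apply: integral_ge0 => x _; exact: IH.
Qed.

Lemma measurable_marginal s F : (forall N, 0 <= F N) ->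
  measurable_fun setT F -> measurable_fun setT (marginal s F).
Proof.
move=> F0 mF; elim: s => //= e s IH.
apply: (@measurable_fun_fubini_tonelli_G _ _ _ _ _ leb
  (fun z : measurableTypeR R * 'M[R]_(m, n) =>
     marginal s F (set_entry e (z.1 : R) z.2))).
  by apply: (measurableT_comp IH); exact: measurable_set_entry.
by move=> z; exact: marginal_ge0.
Qed.

Lemma eq_marginal s F G M :
  (forall N, (forall i j, (i, j) \notin s -> N i j = M i j) -> F N = G N) ->
  marginal s F M = marginal s G M.
Proof.
elim: s M => /= [|e s IH] M FG; first exact: FG.
apply: eq_integral => x _; apply: IH => N NM; apply: FG => i j.
by rewrite inE negb_or => /andP[ije ijs]; rewrite NM// mxE (negbTE ije).
Qed.

(** The entries in [s] are overwritten by the integration variables. *)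
Lemma marginal_local s F M N :
  (forall i j, (i, j) \notin s -> M i j = N i j) ->
  marginal s F M = marginal s F N.
Proof.
elim: s M N => /= [|e s IH] M N MN; first by congr F; apply/matrixP => i j; exact: MN.
apply: eq_integral => x _; apply: IH => i j ijs; rewrite !mxE.
by have [//|ije] := eqVneq (i, j) e; apply: MN; rewrite inE negb_or ije.
Qed.

Lemma marginal_swap e e' s F M : e != e' -> (forall N, 0 <= F N) ->
  measurable_fun setT F ->
  marginal (e :: e' :: s) F M = marginal (e' :: e :: s) F M.
Proof.
move=> ee' F0 mF /=.
rewrite (@fubini_tonelli _ _ (measurableTypeR R) (measurableTypeR R) _ leb leb
  (fun z : measurableTypeR R * measurableTypeR R =>
     marginal s F (set_entry e' (z.2 : R) (set_entry e (z.1 : R) M)))).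
- by apply: eq_integral => y _; apply: eq_integral => x _; rewrite (set_entryC _ _ _ ee').
- apply: (measurableT_comp (measurable_marginal s F0 mF)).
  apply: measurable_set_entry => //.
  by apply: measurable_set_entry => //; exact: measurable_cst.
- by move=> z; exact: marginal_ge0.
Qed.

Lemma perm_marginal s s' F M : uniq s -> perm_eq s s' ->
  (forall N, 0 <= F N) -> measurable_fun setT F ->
  marginal s F M = marginal s' F M.
Proof.
move=> us ss' F0 mF; elim: s s' us ss' M => [|e s IH] s' us ss' M.
  by move: ss'; rewrite perm_sym => /perm_nilP ->.
have es' : e \in s' by rewrite -(perm_mem ss') mem_head.
have us' : uniq s' by rewrite -(perm_uniq ss').
move: us' ss'; case/splitPr: es' => s1 s2 us' ss'.
(* Bring [e] to the front by adjacent exchanges. *)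
have -> : marginal (s1 ++ e :: s2) F M = marginal (e :: s1 ++ s2) F M.
  elim: s1 us' {ss'} M => //= f s1 IH1 /andP[fs1 us1] M.
  have -> : \int[leb]_x \int[leb]_y
      marginal (s1 ++ s2) F (set_entry f y (set_entry e x M)) =
    \int[leb]_y \int[leb]_x
      marginal (s1 ++ s2) F (set_entry e x (set_entry f y M)).
    apply: (@marginal_swap e f (s1 ++ s2) F M) => //.
    by move: fs1; rewrite mem_cat inE !negb_or => /and3P[_ /[1!eq_sym]].
  by apply: eq_integral => x _; exact: IH1.
move: us => /= /andP[es us]; apply: eq_integral => x _; apply: IH => //.
move: ss'; rewrite perm_sym -cat1s perm_catCA /= perm_cons.
by rewrite perm_sym.
Qed.

(** This is where the fixed order of the coordinates of a tuple is traded for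
    an arbitrary list of matrix entries. *)
Lemma marginal_lebesgue_tuple k s F M : size s = k -> uniq s ->
  (forall N, 0 <= F N) -> measurable_fun setT F ->
  marginal s F M = \int[lebesgue_tuple R k]_t F (set_entries s t M).
Proof.
move=> + + F0 mF; elim: k s M => [|k IH] [|e s] M //=.
  move=> _ _; rewrite (integral_lebesgue_tuple0 (fun t => F (set_entries [::] t M))).
  by congr F; apply/matrixP => i j; rewrite mxE.
move=> [sk] /andP[es us].
rewrite (@integral_lebesgue_tupleS _ _ (fun t => F (set_entries (e :: s) t M))).
- apply: eq_integral => x _; rewrite IH//; apply: eq_integral => t _.
  by rewrite /= set_entries_cons// size_tuple.
- exact: (measurableT_comp mF (measurable_set_entries _ _)).
- by move=> t; exact: F0.
Qed.

End partial_integrals.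

(** * Unit lower triangular matrices *)

Section unitriangular.
Context (R : realType) (p : nat).
Implicit Types L N : 'M[R]_p.

Definition unitriangular L := forall i k : 'I_p, (i <= k)%N -> L i k = (i == k)%:R.

Lemma det_unitriangular L : unitriangular L -> \det L = 1.
Proof.
move=> uL; rewrite det_trig; last first.
  by apply/is_trig_mxP => i j ij; rewrite uL ?(ltnW ij)// -val_eqE/= ltn_eqF.
by rewrite big1// => i _; rewrite uL// eqxx.
Qed.

Lemma unitriangular_unit L : unitriangular L -> L \in unitmx.
Proof. by move=> uL; rewrite unitmxE det_unitriangular// unitr1. Qed.

Lemma unitriangular_inv L : unitriangular L -> unitriangular (invmx L).
Proof.
move=> uL.
suff H n (i k : 'I_p) : (i < n)%N -> (i <= k)%N -> invmx L i k = (i == k)%:R.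
  by move=> i k; exact: H.
elim: n i k => // n IH i k; rewrite ltnS => le_in le_ik.
have := mulmxV (unitriangular_unit uL) => /matrixP /(_ i k).
rewrite !mxE (bigD1 i)//= uL// eqxx mul1r big1 ?addr0// => j ji.
have [lij|lji] := ltnP i j.
  by rewrite uL ?(ltnW lij)// eq_sym (negbTE ji) mul0r.
have {}lji : (j < i)%N by rewrite ltn_neqAle lji andbT; exact: ji.
rewrite IH ?(leq_trans lji)// ?(leq_trans (ltnW lji))//.
by rewrite -val_eqE/= ltn_eqF ?mulr0// (leq_trans lji).
Qed.

(** Since L^-1 - N^-1 = L^-1 (N - L) N^-1 and N^-1 is lower triangular, column
    [k] of the difference only involves the columns >= [k] of N - L. *)
Lemma invmx_col_local L N n : unitriangular L -> unitriangular N ->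
  (forall i k : 'I_p, (n <= k)%N -> L i k = N i k) ->
  forall i k : 'I_p, (n <= k)%N -> invmx L i k = invmx N i k.
Proof.
move=> uL uN LN i k nk; apply/eqP; rewrite -subr_eq0; apply/eqP.
have -> : invmx L i k - invmx N i k = (invmx L *m ((N - L) *m invmx N)) i k.
  rewrite mulmxA mulmxBr mulmxBl -mulmxA mulmxV ?unitriangular_unit// mulmx1.
  by rewrite mulVmx ?unitriangular_unit// mul1mx !mxE.
rewrite mxE big1// => l _; rewrite !mxE big1 ?mulr0// => j _.
have [nj|jn] := leqP n j; first by rewrite !mxE LN// subrr mul0r.
rewrite (unitriangular_inv uN) ?(leq_trans (ltnW jn))//.
by rewrite -val_eqE ltn_eqF ?mulr0// (leq_trans jn).
Qed.

End unitriangular.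

(** * The covariance matrix as a function of (D, L) *)

Section dag_parametrization.
Context (R : realType) (p : nat) (E : {set 'I_p * 'I_p}).
Hypothesis hE : parent_ordered_dag E.
Implicit Types (X Y M N : 'M[R]_p) (i j k : 'I_p).

Lemma pa_gt i j : j \in pa E i -> (i < j)%N.
Proof. by rewrite inE => /andP[ji ne]; exact: (hE.2). Qed.

Lemma edgeP j i : ((j, i) \in E) = (j == i) || (j \in pa E i).
Proof.
by rewrite inE; have [->|] := eqVneq j i; rewrite ?(hE.1)//= andbT.
Qed.

(** A pair (D, L) is encoded by a single matrix, so that it can share its
    entries, column by column, with an incomplete matrix: the diagonal stores D,
    the entries indexed by edges store L, and the others are ignored. *)
Definition theta_of X : 'M[R]_p * 'M[R]_p :=
  (\matrix_(i, j) if i == j then X i i else 0,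
   \matrix_(i, j) if i == j then 1 else if (i, j) \in E then X i j else 0).

Definition cov X : 'M[R]_p := Defs.covariance (theta_of X).

Lemma theta_unitriangular X : unitriangular (theta_of X).2.
Proof.
move=> i k ik; rewrite mxE; have [//|ne] := eqVneq i k.
rewrite edgeP (negbTE ne)/=; case: ifPn => // /pa_gt.
by rewrite ltnNge ik.
Qed.

Lemma cov_sym X : (cov X)^T = cov X.
Proof.
rewrite /cov /Defs.covariance !trmx_mul trmxK mulmxA; congr (_ *m _ *m _).
by apply/matrixP => i j; rewrite !mxE eq_sym; case: eqVneq => [->|].
Qed.

Lemma covE X i j :
  cov X i j = \sum_l invmx (theta_of X).2 l i * X l l * invmx (theta_of X).2 l j.
Proof.
rewrite /cov /Defs.covariance mxE; apply: eq_bigr => l _; rewrite mxE.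
rewrite (bigD1 l)//= big1 ?addr0 => [|k kl]; first by rewrite !mxE eqxx.
by rewrite !mxE (negbTE kl) mulr0.
Qed.

(** Columns are compared only where both encodings are meaningful, on [E]. *)
Definition agree_from n X Y : Prop :=
  forall i j, (n <= j)%N -> (i, j) \in E -> X i j = Y i j.

Lemma agree_fromW m n X Y : (m <= n)%N -> agree_from m X Y -> agree_from n X Y.
Proof. by move=> mn XY i j nj; apply: XY; exact: leq_trans nj. Qed.

(** In the sum [covE] only the indices l >= max(i, j) contribute. *)
Lemma cov_local n X Y : agree_from n X Y ->
  forall i j, (n <= i)%N -> (n <= j)%N -> cov X i j = cov Y i j.
Proof.
move=> XY i j ni nj; rewrite !covE; apply: eq_bigr => l _.
have inv k : (n <= k)%N ->
    invmx (theta_of X).2 l k = invmx (theta_of Y).2 l k.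
  apply: invmx_col_local; [exact: theta_unitriangular..|].
  by move=> a b nb; rewrite !mxE; do 2 case: ifP => //; move=> /XY->.
rewrite !inv//; have [nl|ln] := leqP n l.
  by rewrite XY// hE.1.
rewrite (unitriangular_inv (theta_unitriangular Y)); last first.
  by rewrite (leq_trans (ltnW ln)).
by rewrite -val_eqE ltn_eqF ?mul0r// (leq_trans ln).
Qed.

(** Row [i] of L^T Sigma = D L^-1.  As L^-1 is lower triangular with unit
    diagonal, the right-hand side vanishes to the right of the diagonal. *)
Lemma cov_regression X i k : (i <= k)%N ->
  cov X i k + \sum_(j in pa E i) X j i * cov X j k = X i i *+ (i == k).
Proof.
move=> ik; have uL := theta_unitriangular X.
have : (theta_of X).2^T *m cov X = (theta_of X).1 *m invmx (theta_of X).2.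
  rewrite /cov /Defs.covariance !mulmxA -trmx_mul mulVmx ?unitriangular_unit//.
  by rewrite trmx1 mul1mx.
move=> /matrixP /(_ i k).
have -> : ((theta_of X).1 *m invmx (theta_of X).2) i k = X i i *+ (i == k).
  rewrite mxE (bigD1 i)//= [X in _ + X]big1 ?addr0 => [|l li]; last first.
    by rewrite mxE eq_sym (negbTE li) mul0r.
  by rewrite (unitriangular_inv uL)// mxE eqxx mulr_natr.
move=> <-.
rewrite [RHS]mxE [RHS](bigD1 i)//= [X in _ = X * _ + _]mxE.
rewrite [X in _ = X * _ + _]mxE eqxx mul1r; congr (_ + _).
rewrite [RHS](bigID (fun j => j \in pa E i))/=.
rewrite [X in _ = _ + X]big1 ?addr0 => [|j /andP[ji jpa]]; last first.
  by rewrite !mxE (negbTE ji) edgeP (negbTE ji) (negbTE jpa)/= mul0r.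
apply: eq_big => [j|j jpa].
  apply/idP/andP => [jpa|[]//]; split=> //.
  by rewrite -val_eqE/= gtn_eqF// pa_gt.
have ij := pa_gt jpa.
by rewrite !mxE edgeP jpa orbT -val_eqE/= gtn_eqF.
Qed.

End dag_parametrization.

(** * Principal submatrices *)

Section submatrices.
Context (R : realType) (p : nat).

Definition sub_embed n (f : 'I_n -> 'I_p) : 'M[R]_(p, n) := colsub f 1%:M.

Lemma tr_sub_embed_mul n (f : 'I_n -> 'I_p) m (A : 'M[R]_(p, m)) :
  (sub_embed f)^T *m A = rowsub f A.
Proof. by rewrite [RHS]rowsubE /sub_embed trmx_mxsub trmx1. Qed.

Lemma mxsub_embed n (f : 'I_n -> 'I_p) (A : 'M[R]_p) :
  mxsub f f A = (sub_embed f)^T *m A *m sub_embed f.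
Proof.
rewrite tr_sub_embed_mul; apply/matrixP => i j; rewrite !mxE (bigD1 (f j))//=.
rewrite big1 ?addr0 => [|k kf]; first by rewrite !mxE eqxx mulr1.
by rewrite !mxE (negbTE kf) mulr0.
Qed.

Lemma sub_embed_isom n (f : 'I_n -> 'I_p) : injective f ->
  (sub_embed f)^T *m sub_embed f = 1%:M.
Proof.
move=> inj_f; rewrite tr_sub_embed_mul.
by apply/matrixP => i j; rewrite !mxE (inj_eq inj_f).
Qed.

Lemma sub_embedE n (f : 'I_n -> 'I_p) (v : 'cV[R]_n) k : injective f ->
  (sub_embed f *m v) (f k) 0 = v k 0.
Proof.
move=> inj_f; transitivity (((sub_embed f)^T *m (sub_embed f *m v)) k 0).
  by rewrite tr_sub_embed_mul [RHS]mxE.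
by rewrite mulmxA sub_embed_isom// mul1mx.
Qed.

Lemma sub_embed_out n (f : 'I_n -> 'I_p) (v : 'cV[R]_n) i :
  (forall k, f k != i) -> (sub_embed f *m v) i 0 = 0.
Proof.
move=> fi; rewrite mxE big1// => k _.
by rewrite !mxE eq_sym (negbTE (fi k)) mul0r.
Qed.

Lemma positive_mxsub n (f : 'I_n -> 'I_p) (A : 'M[R]_p) : injective f ->
  positive_form A -> positive_form (mxsub f f A).
Proof.
move=> inj_f pA v v0; rewrite mxsub_embed !mulmxA -trmx_mul -2!mulmxA mulmxA.
apply: pA; apply: contra_neq v0 => /(congr1 (mulmx (sub_embed f)^T)).
by rewrite mulmxA sub_embed_isom// mul1mx mulmx0.
Qed.

(** Lets a determinant over a set of indices be computed along any enumeration
    of the set: the two submatrices differ by a permutation applied to rows and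
    columns, whose signs cancel. *)
Lemma det_principal_submx (B : {set 'I_p}) n (f : 'I_n -> 'I_p) (A : 'M[R]_p) :
  injective f -> B =i codom f -> \det (principal_submx B A) = \det (mxsub f f A).
Proof.
move=> inj_f Bf.
have nB : n = #|B| by rewrite (eq_card Bf) card_codom// card_ord.
subst n.
have fB k : f k \in B by rewrite Bf codom_f.
pose s k := enum_rank_in (fB k) (f k).
have gs k : enum_val (s k) = f k by rewrite /s enum_rankK_in.
have inj_s : injective s.
  by move=> k l kl; apply: inj_f; rewrite -!gs kl.
have -> : mxsub f f A = row_perm (perm inj_s) (col_perm (perm inj_s)
    (principal_submx B A)).
  by apply/matrixP => i j; rewrite !mxE !permE !gs.
rewrite row_permE col_permE !det_mulmx det_perm mulrCA det_perm.
by rewrite odd_permV -signr_addb addbb mulr1.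
Qed.

End submatrices.

(** * The inverse parametrization *)

Section inverse_parametrization.
Context (R : realType) (p : nat) (E : {set 'I_p * 'I_p}).
Hypothesis hE : parent_ordered_dag E.
Implicit Types (X Y M N S : 'M[R]_p) (i j : 'I_p).

Definition pa_val i (k : 'I_#|pa E i|) : 'I_p := enum_val k.

Lemma pa_val_inj i : injective (@pa_val i).
Proof. exact: enum_val_inj. Qed.

Lemma pa_val_pa i k : @pa_val i k \in pa E i.
Proof. exact: enum_valP. Qed.

Definition pa_cov X i : 'M[R]_#|pa E i| := principal_submx (pa E i) (cov E X).

Definition pa_col M i : 'cV[R]_#|pa E i| := rowsub (@pa_val i) (col i M).

Lemma pa_colE M i k : pa_col M i k 0 = M (pa_val k) i.
Proof. by rewrite !mxE. Qed.

Lemma pa_covE X i k l : pa_cov X i k l = cov E X (pa_val k) (pa_val l).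
Proof. by rewrite [LHS]mxE. Qed.

Lemma cov_symE X i j : cov E X i j = cov E X j i.
Proof. by rewrite -[in LHS]cov_sym [LHS]mxE. Qed.

Lemma pa_col_regression X i :
  pa_col (cov E X) i = - (pa_cov X i *m pa_col X i).
Proof.
apply/matrixP => k a; rewrite ord1 pa_colE [RHS]mxE.
have ik := pa_gt hE (pa_val_pa k).
have := cov_regression hE X (ltnW ik).
rewrite -val_eqE ltn_eqF// mulr0n cov_symE => reg.
apply/eqP; rewrite -addr_eq0; apply/eqP; rewrite -[RHS]reg; congr (_ + _).
rewrite [LHS]mxE [RHS]big_enum_val; apply: eq_bigr => l _.
by rewrite pa_covE pa_colE mulrC cov_symE.
Qed.

Lemma diag_regression X i :
  cov E X i i = X i i - ((pa_col X i)^T *m pa_col (cov E X) i) 0 0.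
Proof.
have := cov_regression hE X (leqnn i); rewrite eqxx mulr1n => <-.
rewrite (_ : (_ *m _) 0 0 = \sum_(j in pa E i) X j i * cov E X j i) ?addrK//.
rewrite [LHS]mxE [RHS]big_enum_val; apply: eq_bigr => k _.
by rewrite [X in X * _]mxE !pa_colE.
Qed.

(** The form of Sigma at v is that of D at L^-1 v. *)
Lemma cov_positive X : (forall i, 0 < X i i) -> positive_form (cov E X).
Proof.
move=> X0 v v0; have uL := unitriangular_unit (theta_unitriangular hE X).
set L := (theta_of E X).2 in uL.
pose w := invmx L *m v.
have w0 : w != 0.
  by apply: contra_neq v0 => /(congr1 (mulmx L)); rewrite mulKVmx// mulmx0.
have -> : v^T *m cov E X *m v = w^T *m (theta_of E X).1 *m w.
  by rewrite /cov /Defs.covariance trmx_mul !mulmxA.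
have -> : (w^T *m (theta_of E X).1 *m w) 0 0 = \sum_l X l l * w l 0 ^+ 2.
  rewrite mxE; apply: eq_bigr => l _; rewrite mxE (bigD1 l)//= big1 => [|k kl].
    by rewrite !mxE eqxx addr0 mulrAC mulrC expr2.
  by rewrite !mxE (negbTE kl) mulr0.
have [l wl] : exists l, w l 0 != 0.
  by apply/cV0Pn.
rewrite (bigD1 l)//= ltr_wpDr//.
  by apply: sumr_ge0 => k _; rewrite mulr_ge0 ?sqr_ge0// ltW.
by rewrite mulr_gt0// lt_neqAle sqr_ge0 eq_sym sqrf_eq0 wl.
Qed.

Lemma pa_cov_local X Y i : agree_from E i.+1 X Y -> pa_cov X i = pa_cov Y i.
Proof.
move=> XY; apply/matrixP => k l; rewrite !pa_covE.
by apply: (cov_local hE XY); exact: (pa_gt hE (pa_val_pa _)).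
Qed.

(** Parents have larger labels, so [pa_cov X i] does not change when the
    columns <= [i] of X are replaced by ones; the covariance matrix then becomes
    positive definite. *)
Lemma pa_cov_positive X i :
  (forall j, (i < j)%N -> 0 < X j j) -> positive_form (pa_cov X i).
Proof.
move=> X0.
pose Y : 'M[R]_p := \matrix_(a, b) if (b <= i)%N then 1 else X a b.
have XY : agree_from E i.+1 X Y.
  by move=> a b ib _; rewrite mxE leqNgt ib.
rewrite (pa_cov_local XY); apply: positive_mxsub; first exact: enum_val_inj.
apply: cov_positive => j; rewrite mxE; case: ltnP => // ij; exact: X0.
Qed.

Lemma pa_cov_unit X i :
  (forall j, (i < j)%N -> 0 < X j j) -> pa_cov X i \in unitmx.
Proof.
by move=> X0; rewrite unitmxE unitfE gt_eqF// positive_det//; exact: pa_cov_positive.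
Qed.

(** Column [i] of (D, L) recovered from column [i] of the incomplete matrix
    [M], given the parents' covariance, which is read off the columns > [i] of
    the candidate [X].  [sub_embed] puts the coefficients in the rows of the
    parents and zeros elsewhere. *)
Definition regress M X : 'M[R]_p :=
  \matrix_(j, i) if j == i
    then M i i - ((pa_col M i)^T *m invmx (pa_cov X i) *m pa_col M i) 0 0
    else - (sub_embed R (@pa_val i) *m (invmx (pa_cov X i) *m pa_col M i)) j 0.

(** Column [i] of [regress M X] only depends on the columns > [i] of [X], so
    each iteration makes one more column correct, starting from the last. *)
Definition theta_inv M : 'M[R]_p := iter p (regress M) 0.

Lemma pa_col_regress M X i :
  pa_col (regress M X) i = - (invmx (pa_cov X i) *m pa_col M i).
Proof.
apply/matrixP => k a; rewrite ord1 pa_colE mxE -val_eqE/=.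
rewrite gtn_eqF ?(pa_gt hE (pa_val_pa k))// sub_embedE ?mxE//.
exact: pa_val_inj.
Qed.

Lemma regress_out M X i j : (j, i) \notin E -> regress M X j i = 0.
Proof.
rewrite (edgeP hE) negb_or => /andP[ji jpa]; rewrite mxE (negbTE ji).
rewrite sub_embed_out ?oppr0// => k; apply: contraNneq jpa => <-.
exact: pa_val_pa.
Qed.

Lemma pa_col_local n M N i : (n <= i)%N -> agree_from E n M N ->
  pa_col M i = pa_col N i.
Proof.
move=> ni MN; apply/matrixP => k a; rewrite ord1 !pa_colE MN//.
by rewrite (edgeP hE) pa_val_pa orbT.
Qed.

Lemma regress_local n M N X Y : agree_from E n M N -> agree_from E n.+1 X Y ->
  forall i j, (n <= i)%N -> regress M X j i = regress N Y j i.
Proof.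
move=> MN XY i j ni; rewrite !mxE (pa_col_local ni MN).
rewrite (@pa_cov_local X Y i); last exact: agree_fromW XY.
by rewrite MN// hE.1.
Qed.

Lemma agree_fromP n X Y : (p <= n)%N -> agree_from E n X Y.
Proof. by move=> pn i j nj; have := leq_trans pn nj; rewrite leqNgt ltn_ord. Qed.

Lemma iter_regress_out M r i j : (j, i) \notin E -> iter r (regress M) 0 j i = 0.
Proof. by case: r => [|r] ji; [rewrite mxE|exact: regress_out]. Qed.

Lemma theta_inv_fix M : regress M (theta_inv M) = theta_inv M.
Proof.
suff H r : agree_from E (p - r) (iter r (regress M) 0)
    (regress M (iter r (regress M) 0)).
  have := H p; rewrite subnn => Hp; apply/matrixP => j i.
  have [ji|ji] := boolP ((j, i) \in E); first by rewrite -Hp.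
  by rewrite regress_out// /theta_inv iter_regress_out.
elim: r => [|r IH]; first by rewrite subn0; exact: agree_fromP.
move=> i j nj _ /=; apply: regress_local nj => //.
by apply: agree_fromW IH; lia.
Qed.

Lemma theta_inv_out M i j : (j, i) \notin E -> theta_inv M j i = 0.
Proof. by move=> ji; rewrite -theta_inv_fix regress_out. Qed.

(** Both the uniqueness of the fixed point of [regress M] and its dependence on
    [M]: its columns >= [n] are determined by those of [M]. *)
Lemma regress_fix_local n M N X Y : agree_from E n M N ->
  agree_from E 0 (regress M X) X -> agree_from E 0 (regress N Y) Y ->
  agree_from E n X Y.
Proof.
move=> MN XM YN.
suff H r : agree_from E (maxn n (p - r)) X Y.
  by have := H p; rewrite subnn maxn0.
elim: r => [|r IH]; first by apply: agree_fromP; lia.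
move=> i j nj ij; rewrite -XM// -YN//; apply: regress_local nj.
  by apply: agree_fromW MN; lia.
by apply: agree_fromW IH; lia.
Qed.

Lemma theta_inv_local n M N : agree_from E n M N ->
  agree_from E n (theta_inv M) (theta_inv N).
Proof. by move=> MN; apply: (regress_fix_local MN); rewrite theta_inv_fix. Qed.

Lemma dotC n (u v : 'cV[R]_n) : (u^T *m v) 0 0 = (v^T *m u) 0 0.
Proof. by rewrite -{1}[v]trmxK -trmx_mul mxE. Qed.

Lemma edge_cases j i : (j, i) \in E ->
  j = i \/ exists k : 'I_#|pa E i|, j = pa_val k.
Proof.
rewrite (edgeP hE) => /orP[/eqP|jpa]; [by left|right].
by exists (enum_rank_in jpa j); rewrite /pa_val enum_rankK_in.
Qed.

(** Positivity is used to invert the parents' covariance matrices; the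
    regression equations then give back the entries of [M]. *)
Lemma cov_theta_inv M : (forall i, 0 < theta_inv M i i) ->
  agree_from E 0 (cov E (theta_inv M)) M.
Proof.
move=> M0 j i _ ji; set X := theta_inv M in M0 *.
have XM : regress M X = X by exact: theta_inv_fix.
have Aunit : pa_cov X i \in unitmx by exact: pa_cov_unit.
have xE : pa_col X i = - (invmx (pa_cov X i) *m pa_col M i).
  by rewrite -[in LHS]XM pa_col_regress.
have uE : pa_col (cov E X) i = pa_col M i.
  by rewrite pa_col_regression xE mulmxN opprK mulKVmx.
case: (edge_cases ji) => [->|[k ->]]; last by rewrite -!pa_colE uE.
rewrite diag_regression uE dotC xE mulmxN mulmxA [X in _ - X]mxE opprK.
by rewrite -[in X i i]XM mxE eqxx subrK.
Qed.

Lemma regress_cov X : (forall i, 0 < X i i) ->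
  agree_from E 0 (regress (cov E X) X) X.
Proof.
move=> X0 j i _ ji.
have Aunit : pa_cov X i \in unitmx by exact: pa_cov_unit.
have AuE : invmx (pa_cov X i) *m pa_col (cov E X) i = - pa_col X i.
  by rewrite pa_col_regression mulmxN mulKmx.
case: (edge_cases ji) => [->|[k ->]].
  rewrite mxE eqxx -mulmxA AuE mulmxN [X in _ - X]mxE opprK dotC.
  by rewrite diag_regression subrK.
by rewrite -!pa_colE pa_col_regress AuE opprK.
Qed.

(** The regression equations say that [X] is a fixed point of
    [regress (cov X)], and there is only one. *)
Lemma theta_inv_cov X : (forall i, 0 < X i i) ->
  agree_from E 0 (theta_inv (cov E X)) X.
Proof.
move=> X0; apply: (@regress_fix_local 0 (cov E X) (cov E X)) => //.
  by rewrite theta_inv_fix.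
exact: regress_cov.
Qed.

End inverse_parametrization.

(** * Measurability of the inverse parametrization *)

Section matrix_functions.
Context (R : realType) d (T : measurableType d).

Lemma measurable_trmx m n (f : T -> 'M[R]_(m, n)) :
  measurable_fun setT f -> measurable_fun setT (fun x => (f x)^T).
Proof.
move=> /measurable_matrixP mf; apply/measurable_matrixP => i j.
by under eq_fun do rewrite mxE; exact: mf.
Qed.

Lemma measurable_mxsub m n m' n' (g : 'I_m' -> 'I_m) (h : 'I_n' -> 'I_n)
    (f : T -> 'M[R]_(m, n)) :
  measurable_fun setT f -> measurable_fun setT (fun x => mxsub g h (f x)).
Proof.
move=> /measurable_matrixP mf; apply/measurable_matrixP => i j.
by under eq_fun do rewrite mxE; exact: mf.
Qed.

Lemma measurable_det n (f : T -> 'M[R]_n) :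
  measurable_fun setT f -> measurable_fun setT (fun x => \det (f x)).
Proof.
move=> /measurable_matrixP mf; apply: measurable_sum => s.
by apply: measurable_funM => //; apply: measurable_prod => i _; exact: mf.
Qed.

Lemma measurable_mxtrace n (f : T -> 'M[R]_n) :
  measurable_fun setT f -> measurable_fun setT (fun x => \tr (f x)).
Proof.
by move=> /measurable_matrixP mf; apply: measurable_sum => i; exact: mf.
Qed.

Lemma measurable_funV (f : T -> R) :
  measurable_fun setT f -> measurable_fun setT (fun x => (f x)^-1).
Proof.
move=> mf; rewrite (_ : (fun _ => _) = fun x => f x * (f x ^+ 2) `^ (-1)).
  (* x^-1 = x (x^2)^-1 also holds at 0, and powers of a nonnegative base are
     measurable. *)
  apply: measurable_funM => //.
  apply: (measurableT_comp (@measurable_powR R (-1))).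
  exact: measurable_funX.
apply/funext => x; rewrite powR_inv1 ?sqr_ge0//.
have [->|fx0] := eqVneq (f x) 0; first by rewrite invr0 mul0r.
by rewrite expr2 invfM mulrA mulfV// mul1r.
Qed.

Lemma measurable_invmx n (f : T -> 'M[R]_n) :
  measurable_fun setT f -> measurable_fun setT (fun x => invmx (f x)).
Proof.
move=> mf; rewrite /invmx; apply: measurable_fun_ifT => //.
  under eq_fun do rewrite unitmxE unitfE.
  apply: (measurableT_comp (f := negb)) => //.
  by apply: measurable_fun_eqr => //; exact: measurable_det.
apply/measurable_matrixP => i j; under eq_fun do rewrite !mxE.
apply: measurable_funM; first exact/measurable_funV/measurable_det.
apply: measurable_funM => //; apply: measurable_det.
rewrite /row' /col' (_ : (fun _ => _) = fun x => mxsub (lift j) (lift i) (f x)).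
  exact: measurable_mxsub.
by apply/funext => x; apply/matrixP => a b; rewrite !mxE.
Qed.

End matrix_functions.

Section measurable_parametrization.
Context (R : realType) (p : nat) (E : {set 'I_p * 'I_p}).
Context d (T : measurableType d).
Implicit Types f g : T -> 'M[R]_p.

Lemma measurable_theta_of f : measurable_fun setT f ->
  measurable_fun setT (fun x => (theta_of E (f x)).1) /\
  measurable_fun setT (fun x => (theta_of E (f x)).2).
Proof.
move=> /measurable_matrixP mf; split; apply/measurable_matrixP => i j.
  under eq_fun do rewrite mxE.
  by case: (i == j); [exact: mf|exact: measurable_cst].
under eq_fun do rewrite mxE; case: (i == j); first exact: measurable_cst.
by case: (_ \in _); [exact: mf|exact: measurable_cst].
Qed.

Lemma measurable_cov f : measurable_fun setT f ->
  measurable_fun setT (fun x => cov E (f x)).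
Proof.
move=> /measurable_theta_of[mD mL]; have mLi := measurable_invmx mL.
apply: measurable_mulmx => //; apply: measurable_mulmx => //.
exact: measurable_trmx.
Qed.

Lemma measurable_regress f g : measurable_fun setT f -> measurable_fun setT g ->
  measurable_fun setT (fun x => regress E (f x) (g x)).
Proof.
move=> mf mg; have mc i : measurable_fun setT (fun x => pa_col E (f x) i).
  exact/measurable_mxsub/measurable_mxsub.
have mA i : measurable_fun setT (fun x => invmx (pa_cov E (g x) i)).
  exact/measurable_invmx/measurable_mxsub/measurable_cov.
apply/measurable_matrixP => j i; under eq_fun do rewrite mxE.
case: (j == i).
  apply: measurable_funB; first exact: (proj1 (measurable_matrixP _) mf).
  apply: (proj1 (measurable_matrixP _)); apply: measurable_mulmx => //.
  by apply: measurable_mulmx => //; exact: measurable_trmx.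
apply: measurable_funN; apply: (proj1 (measurable_matrixP _)).
by apply: measurable_mulmx => //; exact: measurable_mulmx.
Qed.

Lemma measurable_theta_inv f : measurable_fun setT f ->
  measurable_fun setT (fun x => theta_inv E (f x)).
Proof.
move=> mf; rewrite /theta_inv; set r := (X in iter X); clearbody r.
elim: r => [|r IH] //=; exact: measurable_regress.
Qed.

End measurable_parametrization.

Definition positive_diag (R : realType) p : set 'M[R]_p :=
  [set X | forall i, 0 < X i i].

Lemma measurable_positive_diag (R : realType) p :
  measurable (@positive_diag R p).
Proof.
rewrite (_ : @positive_diag R p =
    \bigcap_(i in [set: 'I_p]) [set X : 'M[R]_p | 0 < X i i]).
  apply: fin_bigcap_measurable => // i _.
  rewrite -[X in measurable X]setTI (_ : [set X : 'M[R]_p | _] =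
    (fun X : 'M[R]_p => X i i) @^-1` `]0, +oo[).
    by apply: measurable_entry => //; exact: measurable_itv.
  by apply/seteqP; split=> X /=; rewrite in_itv/= andbT.
by apply/seteqP; split=> [X X0 i _|X X0 i]; exact: X0.
Qed.

(** * The spaces PD_D and S_D *)

Section covariance_spaces.
Context (R : realType) (p : nat) (E : {set 'I_p * 'I_p}).
Hypothesis hE : parent_ordered_dag E.
Implicit Types (X M A : 'M[R]_p) (t : #|E|.-tuple R).

Definition fill t : 'M[R]_p := set_entries (enum E) t 0.

Lemma theta_of_coordE t : theta_of_coord t = theta_of E (fill t).
Proof.
by congr pair; apply/matrixP => i j; rewrite !mxE //=.
Qed.

Lemma incomplete_fill t : incomplete E (fill t) = t.
Proof.
apply: eq_from_tnth => k; rewrite tnth_mktuple mxE mxE -surjective_pairing.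
rewrite index_uniq ?enum_uniq ?enum_valK//; last by rewrite -cardE.
by rewrite (tnth_nth 0).
Qed.

Lemma incomplete_eqP M N : incomplete E M = incomplete E N <-> agree_from E 0 M N.
Proof.
split=> [MN i j _ ij|MN]; last first.
  apply: eq_from_tnth => k; rewrite !tnth_mktuple MN//.
  by rewrite -surjective_pairing enum_valP.
have := congr1 (fun t => tnth t (enum_rank_in ij (i, j))) MN.
by rewrite !tnth_mktuple enum_rankK_in.
Qed.

Lemma ThetaP X : Theta E (theta_of E X) <-> positive_diag X.
Proof.
split=> [[_ D0 _] i|X0]; first by have := D0 i; rewrite mxE eqxx.
split=> /= [|i|]; last split.
- by apply/is_diag_mxP => i j ij; rewrite mxE -val_eqE (negbTE ij).
- by rewrite mxE eqxx.
- apply/is_trig_mxP => i j ij.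
  by rewrite (theta_unitriangular hE X) ?(ltnW ij)// -val_eqE/= ltn_eqF.
- by move=> i; rewrite mxE eqxx.
- move=> i j ij ipa; rewrite mxE (negbTE ij).
  by rewrite edgeP// (negbTE ij) (negbTE ipa).
Qed.

Lemma Theta_theta_of DL : Theta E DL -> exists X, DL = theta_of E X.
Proof.
case: DL => D L [/= dD D0 [tL L1 L0]].
exists (\matrix_(i, j) if i == j then D i i else L i j).
congr pair; apply/matrixP => i j; rewrite !mxE.
  rewrite eqxx; case: eqVneq => [->//|ij].
  by move/is_diag_mxP: dD => ->//; rewrite -val_eqE.
case: eqVneq => [->//|ij]; rewrite edgeP// (negbTE ij)/=.
by case: ifPn => // ipa; rewrite L0.
Qed.

Lemma cov_agree X Y : agree_from E 0 X Y -> cov E X = cov E Y.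
Proof. by move=> XY; apply/matrixP => i j; exact: (cov_local hE XY). Qed.

Lemma PDP A : PD E A <->
  positive_diag (theta_inv E A) /\ cov E (theta_inv E A) = A.
Proof.
split=> [[DL Th <-]|[X0 XA]]; last first.
  by exists (theta_of E (theta_inv E A)) => //; apply/ThetaP.
have [X DLE] := Theta_theta_of Th; move: Th; rewrite DLE => /ThetaP X0.
have XX := theta_inv_cov hE X0; split; last exact: cov_agree.
by move=> i; rewrite XX// hE.1.
Qed.

(** An element of PD_D is the covariance of its image by [theta_inv], which only
    reads the entries in [E]. *)
Lemma completion_incomplete A : PD E A -> completion (incomplete E A) = A.
Proof.
move=> PA; apply: xget_unique => // B [PB AB].
have {AB}/incomplete_eqP AB := AB.
have [_ <-] := (PDP B).1 PB; have [_ <-] := (PDP A).1 PA.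
exact/cov_agree/theta_inv_local.
Qed.

Lemma incomplete_cov_theta_inv t : positive_diag (theta_inv E (fill t)) ->
  incomplete E (cov E (theta_inv E (fill t))) = t.
Proof.
move=> t0; rewrite -[RHS]incomplete_fill; apply/incomplete_eqP.
exact: cov_theta_inv.
Qed.

Lemma S_DP t : S_D R E t <-> positive_diag (theta_inv E (fill t)).
Proof.
split=> [[A PA At]|t0].
  have AF : agree_from E 0 A (fill t).
    by apply/incomplete_eqP; rewrite incomplete_fill.
  move=> i; rewrite -(theta_inv_local hE AF) ?hE.1//.
  exact: ((PDP A).1 PA).1.
exists (cov E (theta_inv E (fill t))).
  by exists (theta_of E (theta_inv E (fill t))) => //; apply/ThetaP.
exact: incomplete_cov_theta_inv.
Qed.

Lemma completionE t : S_D R E t -> completion t = cov E (theta_inv E (fill t)).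
Proof.
move=> [A PA At]; rewrite -At completion_incomplete//.
have [_ {1}<-] := (PDP A).1 PA; apply/cov_agree/theta_inv_local => //.
by apply/incomplete_eqP; rewrite incomplete_fill.
Qed.

Lemma measurable_incomplete : measurable_fun setT (@incomplete R p E).
Proof.
apply/measurable_fun_tnthP => k.
rewrite (_ : _ \o _ = fun A : 'M[R]_p => A (enum_val k).1 (enum_val k).2).
  exact: measurable_entry.
by apply/funext => A; rewrite /= tnth_mktuple.
Qed.

Lemma measurable_fill : measurable_fun setT fill.
Proof. exact: measurable_set_entries. Qed.

Lemma measurable_S_D : measurable (S_D R E).
Proof.
rewrite (_ : S_D R E = (fun t => theta_inv E (fill t)) @^-1` @positive_diag R p).
  rewrite -[X in measurable X]setTI.
  apply: measurable_theta_inv => //; first exact: measurable_fill.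
  exact: measurable_positive_diag.
by apply/seteqP; split=> t /S_DP.
Qed.

End covariance_spaces.

(** * Densities in the two coordinate systems *)

Section density_identity.
Context (R : realType) (p : nat) (E : {set 'I_p * 'I_p}).
Hypothesis hE : parent_ordered_dag E.
Implicit Types (X U : 'M[R]_p) (i : 'I_p).

(** By the regression equations, subtracting from the column of [i] its
    regression on the columns of the parents leaves X_ii on the diagonal and
    zeros below. *)
Lemma det_fa_cov X i :
  \det (principal_submx (fa E i) (cov E X)) = X i i * \det (pa_cov E X i).
Proof.
set m := #|pa E i|.
(* Enumerate fa(i) with [i] first, so as to expose the block structure. *)
pose f (k : 'I_(1 + m)) : 'I_p :=
  match fintype.split k with inl _ => i | inr l => @pa_val _ E i l end.
have fl k : f (lshift m k) = i by rewrite /f (unsplitK (inl k)).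
have fr l : f (rshift 1 l) = @pa_val _ E i l by rewrite /f (unsplitK (inr l)).
have i_val (l : 'I_m) : i != @pa_val _ E i l.
  by rewrite -val_eqE/= ltn_eqF// (pa_gt hE (pa_val_pa l)).
have inj_f : injective f.
  move=> a b; rewrite -[a]fintype.splitK -[b]fintype.splitK.
  case: (fintype.split a) (fintype.split b) => [a'|a'] [b'|b'] /=.
  - by rewrite !ord1.
  - by rewrite fl fr => /eqP; rewrite (negbTE (i_val _)).
  - by rewrite fl fr => /esym /eqP; rewrite (negbTE (i_val _)).
  - by rewrite !fr => /pa_val_inj ->.
rewrite (det_principal_submx _ inj_f); last first.
  move=> j; rewrite in_setU1; apply/idP/codomP => [/orP[/eqP ->|jpa]|[k ->]].
  - by exists (lshift m 0); rewrite fl.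
  - exists (rshift 1 (enum_rank_in jpa j)).
    by rewrite fr /pa_val enum_rankK_in.
  - rewrite -[k]fintype.splitK; case: (fintype.split k) => l /=.
      by rewrite fl eqxx.
    by rewrite fr pa_val_pa orbT.
set B := mxsub _ _ _.
pose s := pa_col E (cov E X) i; pose x := pa_col E X i.
have BE : B = block_mx (cov E X i i)%:M s^T s (pa_cov E X i).
  apply/matrixP => a b; rewrite [LHS]mxE.
  rewrite -[a]fintype.splitK -[b]fintype.splitK.
  case: (fintype.split a) (fintype.split b) => [a'|a'] [b'|b'] /=.
  - by rewrite !fl block_mxEul [RHS]mxE !ord1 eqxx mulr1n.
  - by rewrite fl fr block_mxEur [RHS]mxE ord1 pa_colE cov_symE.
  - by rewrite fl fr block_mxEdl ord1 pa_colE.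
  - by rewrite !fr block_mxEdr pa_covE.
have : B *m block_mx 1%:M 0 x 1%:M =
    block_mx (X i i)%:M s^T 0 (pa_cov E X i).
  rewrite BE mulmx_block !mulmx1 !mulmx0 !add0r; congr block_mx.
    rewrite [s^T *m x]mx11_scalar -raddfD; congr _%:M.
    by rewrite diag_regression// dotC subrK.
  by rewrite /s pa_col_regression// addNr.
move=> /(congr1 determinant).
by rewrite det_mulmx det_lblock !det1 !mulr1 det_ublock det_scalar1.
Qed.

Lemma cov_inv X : positive_diag X ->
  invmx (cov E X) =
  (theta_of E X).2 *m invmx (theta_of E X).1 *m (theta_of E X).2^T.
Proof.
move=> X0; have uL := unitriangular_unit (theta_unitriangular hE X).
have uLT : (theta_of E X).2^T \in unitmx by rewrite unitmx_tr.
have uD : (theta_of E X).1 \in unitmx.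
  rewrite unitmxE unitfE det_trig; last first.
    by apply/is_trig_mxP => i j ij; rewrite mxE -val_eqE/= ltn_eqF.
  by apply/prodf_neq0 => i _; rewrite mxE eqxx gt_eqF.
set N := RHS; have SN : cov E X *m N = 1%:M.
  rewrite /N /cov /Defs.covariance trmx_inv !mulmxA mulmxKV// mulmxK//.
  by rewrite mulVmx.
have [uS _] := mulmx1_unit SN.
by rewrite -[RHS]mul1mx -(mulVmx uS) -mulmxA SN mulmx1.
Qed.

(** The contribution of the columns >= [n] to the Jacobian of Gamma -> (D, L),
    as a function of (D, L). *)
Definition jacobian_from n X : R :=
  \prod_(i < p | (n <= i)%N) `|\det (pa_cov E X i)|^-1.

Lemma density_change U alpha X : positive_diag X ->
  dw_theta_density E U alpha (theta_of E X) * jacobian_from 0 X =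
  (dw_z E U alpha)^-1 * expR (- (1 / 2) * \tr (invmx (cov E X) *m U))
  * \prod_(i < p)
      (\det (principal_submx (fa E i) (cov E X)) `^ (- (1 / 2) * alpha i)
       / \det (principal_submx (pa E i) (cov E X)) `^ (- (1 / 2) * alpha i + 1)).
Proof.
move=> X0; rewrite cov_inv// /dw_theta_density -[LHS]mulrA; congr (_ * _).
rewrite /jacobian_from (eq_bigl xpredT)// -big_split/=; apply: eq_bigr => i _.
rewrite mxE eqxx det_fa_cov -/(pa_cov E X i).
have a0 : 0 < \det (pa_cov E X i).
  by apply/positive_det/pa_cov_positive => // j _; exact: X0.
rewrite gtr0_norm// powRM ?(ltW (X0 i)) ?(ltW a0)//.
have a1 := lt0r_neq0 a0.
rewrite powRD ?a1 ?implybT// powRr1 ?ltW//.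
rewrite (_ : - (alpha i / 2) = - (1 / 2) * alpha i); last by field.
have := lt0r_neq0 (powR_gt0 (- (1 / 2) * alpha i) a0).
move: (\det _ `^ _) (X i i `^ _) => b c b0; field.
by rewrite a1.
Qed.

End density_identity.

(** * The change of variables, column by column *)

Section change_of_variables.
Context (R : realType) (p : nat) (E : {set 'I_p * 'I_p}).
Hypothesis hE : parent_ordered_dag E.
Implicit Types (X M N : 'M[R]_p) (i j : 'I_p).

Definition edges_to i : seq ('I_p * 'I_p) :=
  [seq (@pa_val _ E i k, i) | k <- enum 'I_#|pa E i|].

(** The coordinates of the columns < [n], the last column being integrated
    outermost.  Within a column the diagonal entry comes last, hence is
    integrated innermost: its shear depends on the other entries of the
    column. *)
Fixpoint columns_below n : seq ('I_p * 'I_p) :=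
  if n is m.+1 then
    oapp (fun i => rcons (edges_to i) (i, i)) [::] (insub m) ++ columns_below m
  else [::].

Lemma size_edges_to i : size (edges_to i) = #|pa E i|.
Proof. by rewrite size_map size_enum_ord. Qed.

Lemma edges_to_inj i : injective (fun k => (@pa_val _ E i k, i)).
Proof. by move=> k l [/pa_val_inj]. Qed.

Lemma edges_to_uniq i : uniq (edges_to i).
Proof. by rewrite map_inj_uniq ?enum_uniq//; exact: edges_to_inj. Qed.

Lemma index_edges_to i k : index (@pa_val _ E i k, i) (edges_to i) = k.
Proof. by rewrite index_map ?index_enum_ord//; exact: edges_to_inj. Qed.

Lemma mem_edges_to i a b : ((a, b) \in edges_to i) = (b == i) && (a \in pa E i).
Proof.
apply/mapP/andP => [[k _ [-> ->]]|[/eqP -> api]].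
  by rewrite eqxx pa_val_pa.
exists (enum_rank_in api a); first by rewrite mem_enum.
by rewrite /pa_val enum_rankK_in.
Qed.

Lemma loop_notin_edges_to i : (i, i) \notin edges_to i.
Proof. by rewrite mem_edges_to eqxx/= !inE eqxx andbF. Qed.

Lemma mem_block i a b : ((a, b) \in rcons (edges_to i) (i, i)) =
  ((a, b) \in E) && (b == i).
Proof.
rewrite mem_rcons inE mem_edges_to xpair_eqE edgeP//.
by case: (eqVneq b i) => [->|]; rewrite ?andbT ?andbF.
Qed.

Lemma mem_columns_below n a b :
  ((a, b) \in columns_below n) = ((a, b) \in E) && (b < n)%N.
Proof.
elim: n => [|n IH]; first by rewrite andbF.
rewrite /= mem_cat IH; case: insubP => [i /= ltnp ni|pn] /=.
  by rewrite mem_block -andb_orr -val_eqE/= ni -leq_eqVlt ltnS.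
by rewrite !(leq_trans (ltn_ord b))// ?leqW// leqNgt.
Qed.

Lemma uniq_columns_below n : uniq (columns_below n).
Proof.
elim: n => //= n IH; rewrite cat_uniq IH andbT; apply/andP; split.
  case: insubP => [i _ _|_] //=.
  by rewrite rcons_uniq loop_notin_edges_to edges_to_uniq.
apply/hasPn => -[a b]; rewrite mem_columns_below => /andP[_ bn].
case: insubP => [i /= _ ni|_] //=.
by rewrite mem_block negb_and -val_eqE/= ni ltn_eqF// orbT.
Qed.

Lemma perm_columns_below : perm_eq (columns_below p) (enum E).
Proof.
apply: uniq_perm; rewrite ?uniq_columns_below ?enum_uniq// => -[a b].
by rewrite mem_columns_below ltn_ord andbT mem_enum.
Qed.

Definition tuple_col n (v : 'cV[R]_n) : n.-tuple R := [tuple v k 0 | k < n].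

Lemma tuple_colK n (t : n.-tuple R) : tuple_col (col_tuple t) = t.
Proof. by apply: eq_from_tnth => k; rewrite tnth_mktuple mxE. Qed.

Lemma measurable_tuple_col n : measurable_fun setT (@tuple_col n).
Proof.
apply/measurable_fun_tnthP => k.
rewrite (_ : _ \o _ = fun v : 'cV[R]_n => v k 0); first exact: measurable_entry.
by apply/funext => v; rewrite /= tnth_mktuple.
Qed.

(** The effect on [theta_inv] of changing column [i] of an incomplete matrix:
    an explicit map on column [i] and, apart from columns < [i], nothing
    else. *)
Lemma theta_inv_block M i (t : #|pa E i|.-tuple R) (y : R) a b :
  let A := pa_cov E (theta_inv E M) i in
  let w := col_tuple t in
  (a, b) \notin columns_below i ->
  theta_inv E (set_entry (i, i) y (set_entries (edges_to i) t M)) a b =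
  set_entry (i, i) (y - (w^T *m invmx A *m w) 0 0)
    (set_entries (edges_to i) (tuple_col (- (invmx A *m w))) (theta_inv E M)) a b.
Proof.
move=> A w; set M' := set_entry _ _ _; rewrite mem_columns_below.
have nth_out (x : R) (s : seq R) c d :
    size s = #|pa E i| -> (c, d) \notin edges_to i ->
    nth x s (index (c, d) (edges_to i)) = x.
  by move=> ss cd; rewrite nth_default// memNindex// size_edges_to ss.
have MM' : agree_from E i.+1 M' M.
  move=> c d ltid _; have di : d != i by rewrite -val_eqE/= gtn_eqF.
  by rewrite !mxE xpair_eqE (negbTE di) andbF nth_out ?size_tuple// mem_edges_to (negbTE di).
have [abE|abE _] := boolP ((a, b) \in E); last first.
  rewrite theta_inv_out// !mxE.
  have -> : ((a, b) == (i, i)) = false.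
    by apply: contraNF abE => /eqP[-> ->]; exact: hE.1.
  rewrite nth_out ?size_tuple ?theta_inv_out// mem_edges_to.
  by apply: contraNN abE => /andP[/eqP -> api]; rewrite edgeP// api orbT.
rewrite andTb -leqNgt leq_eqVlt => /orP[/eqP/val_inj ib|ltib]; last first.
  have bi : b != i by rewrite -val_eqE/= gtn_eqF.
  rewrite !mxE xpair_eqE (negbTE bi) andbF nth_out ?size_tuple//.
    exact: (theta_inv_local hE MM').
  by rewrite mem_edges_to (negbTE bi).
subst b; rewrite -theta_inv_fix//.
have colM' : pa_col E M' i = w.
  apply/matrixP => k c; rewrite ord1 pa_colE !mxE xpair_eqE.
  rewrite -val_eqE/= gtn_eqF ?(pa_gt hE (pa_val_pa k))//= index_edges_to.
  by rewrite (tnth_nth (M (pa_val k) i)).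
have AM' : pa_cov E (theta_inv E M') i = A.
  by apply: pa_cov_local => //; exact: theta_inv_local.
case: (edge_cases hE abE) => [->|[k ->]].
  by rewrite mxE eqxx colM' AM' !mxE eqxx.
rewrite -pa_colE pa_col_regress// colM' AM' [RHS]mxE xpair_eqE.
rewrite -val_eqE/= gtn_eqF ?(pa_gt hE (pa_val_pa k))//= [RHS]mxE index_edges_to.
rewrite -[RHS]/(nth _ (tuple_col (- (invmx A *m w))) k).
by rewrite -tnth_nth tnth_mktuple.
Qed.

Lemma jacobian_from_local n X Y : agree_from E n.+1 X Y ->
  jacobian_from E n X = jacobian_from E n Y.
Proof.
move=> XY; apply: eq_bigr => i ni; rewrite (@pa_cov_local _ _ _ hE X Y)//.
exact: agree_fromW XY.
Qed.

Lemma jacobian_fromS X i :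
  jacobian_from E i X = `|\det (pa_cov E X i)|^-1 * jacobian_from E i.+1 X.
Proof.
rewrite /jacobian_from (bigD1 i)//=; congr (_ * _); apply: eq_bigl => j.
by rewrite -val_eqE/= eq_sym ltn_neqAle andbC.
Qed.

Lemma jacobian_from_ge0 n X : 0 <= jacobian_from E n X.
Proof. by apply: prodr_ge0 => i _; rewrite invr_ge0. Qed.

Lemma marginal_eq0 s (F : 'M[R]_p -> \bar R) M :
  (forall N, (forall i j, (i, j) \notin s -> N i j = M i j) -> F N = 0%E) ->
  marginal s F M = 0%E.
Proof.
move=> F0; rewrite (@eq_marginal _ _ _ _ _ (cst 0%E))//.
by elim: s M {F0} => //= e s IH M; under eq_integral do rewrite IH; rewrite integral0.
Qed.

(** The change of variables in a single column.  The diagonal coordinate is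
    shifted by a quantity that depends on the other entries only, and these
    undergo the linear map - A^-1, with A the parents' covariance matrix. *)
Lemma marginal_block (G : 'M[R]_p -> \bar R) (c : R) i M :
  (forall N, 0 <= G N)%E -> measurable_fun setT G -> 0 <= c ->
  (forall N N', (forall a b, (a, b) \notin columns_below i -> N a b = N' a b) ->
     G N = G N') ->
  (forall j, (i < j)%N -> 0 < theta_inv E M j j) ->
  let block := rcons (edges_to i) (i, i) in
  (marginal block (fun N => c%:E * G (theta_inv E N)) M =
   (c * `|\det (pa_cov E (theta_inv E M) i)|)%:E *
     marginal block G (theta_inv E M))%E.
Proof.
move=> G0 mG c0 locG Mpos block.
set X := theta_inv E M in Mpos *; set A := pa_cov E X i.
have pA : positive_form A by exact: pa_cov_positive.
have uA : A \in unitmx by rewrite unitmxE unitfE gt_eqF// positive_det.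
have mc : measurable_fun setT (fun N => c%:E * G (theta_inv E N))%E.
  apply: emeasurable_funM => //; apply: (measurableT_comp mG).
  exact: measurable_theta_inv.
have c0' N : (0 <= c%:E * G (theta_inv E N))%E by rewrite mule_ge0.
rewrite /block -cats1 !marginal_cat.
rewrite !(marginal_lebesgue_tuple _ (size_edges_to i) (edges_to_uniq i)); last 4 first.
- by move=> N; exact: marginal_ge0.
- exact: measurable_marginal.
- by move=> N; exact: marginal_ge0.
- exact: measurable_marginal.
(* The integrand once the diagonal coordinate is integrated out, as a function
   of the off-diagonal coordinates of (D, L). *)
pose Psi (v : 'cV[R]_#|pa E i|) :=
  marginal [:: (i, i)] G (set_entries (edges_to i) (tuple_col v) X).
have Psi0 v : (0 <= Psi v)%E by exact: marginal_ge0.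
have mPsi : measurable_fun setT Psi.
  apply: (measurableT_comp (measurable_marginal [:: (i, i)] G0 mG)).
  exact: (measurableT_comp (@measurable_set_entries R p p _ (edges_to i) X)
    (@measurable_tuple_col _)).
have inner (t : #|pa E i|.-tuple R) :
    marginal [:: (i, i)] (fun N => c%:E * G (theta_inv E N))%E
      (set_entries (edges_to i) t M) =
    (c%:E * Psi (- (invmx A *m col_tuple t))%R)%E.
  rewrite /=; set w := col_tuple t.
  set q := (w^T *m invmx A *m w) 0 0.
  pose N := set_entries (edges_to i) (tuple_col (- (invmx A *m w))) X.
  have mGN : measurable_fun setT (fun y : R => G (set_entry (i, i) y N)).
    by apply: (measurableT_comp mG); exact: measurable_set_entry.
  under eq_integral => y _.
    rewrite (locG _ (set_entry (i, i) (1 * y - q) N)); first over.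
    by move=> a b ab; rewrite mul1r; exact: theta_inv_block.
  rewrite ge0_integralZl//; last first.
    apply: (measurableT_comp mG); apply: measurable_set_entry => //.
    exact: (measurable_affine 1 (- q)).
  congr (_ * _)%E; rewrite /Psi/= -/N.
  rewrite -(@integral_affine _ 1 (- q) (fun y => G (set_entry (i, i) y N)))//.
  by rewrite normr1 mul1e.
have mPsiA : measurable_fun setT (fun v => Psi (- (invmx A *m v))).
  apply: (measurableT_comp mPsi).
  by under eq_fun do rewrite -mulNmx; exact: measurable_mulmx.
transitivity (c%:E * \int[lebesgue_tuple R #|pa E i|]_t
    Psi (- (invmx A *m col_tuple t))%R)%E.
  have mPsit := measurableT_comp mPsiA (@measurable_col_tuple R #|pa E i|).
  rewrite -(ge0_integralZl (lebesgue_tuple R _) measurableT mPsit)//.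
    by apply: eq_integral => t _; exact: inner.
  by move=> t _; exact: Psi0.
rewrite EFinM -muleA; congr (_ * _)%E.
have aA : anisotropic (- A) by exact/anisotropicN/positive_anisotropic.
have lin := integral_linear 0 aA mPsiA (fun=> Psi0 _); rewrite -[LHS]lin {lin}.
(* The substitution t := - A t undoes the linear map - A^-1. *)
have PsiK (t : #|pa E i|.-tuple R) :
    Psi (- (invmx A *m (- A *m col_tuple t + 0)))%R =
    marginal [:: (i, i)] G (set_entries (edges_to i) t X).
  by rewrite addr0 mulNmx mulmxN opprK mulKmx// /Psi tuple_colK.
under eq_integral do rewrite PsiK.
by rewrite -[- A]scaleN1r detZ normrM normrX normrN1 expr1n mul1r.
Qed.

(** Once the columns >= [n] are fixed, the columns < [n] of Gamma can be traded
    for those of (D, L).  If some D_jj with j >= [n] is not positive, both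
    sides vanish because [H] does; otherwise the parents'
    covariance matrix of the new column is invertible and [marginal_block]
    applies. *)
Lemma marginal_change (H : 'M[R]_p -> \bar R) n M :
  (forall N, 0 <= H N)%E -> measurable_fun setT H ->
  (forall N, ~ positive_diag N -> H N = 0%E) -> (n <= p)%N ->
  (marginal (columns_below n)
    (fun N => (jacobian_from E 0 (theta_inv E N))%:E * H (theta_inv E N)) M =
   (jacobian_from E n (theta_inv E M))%:E *
     marginal (columns_below n) H (theta_inv E M))%E.
Proof.
move=> H0 mH Hpos; set K := (fun N => _).
elim: n M => [//|n IH] M ltnp.
have [Mpos|/existsNP[j /not_implyP[nj Mj]]] :=
    pselect (forall j : 'I_p, (n < j)%N -> 0 < theta_inv E M j j); last first.
  have Eout a : (a, j) \notin columns_below n.+1.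
    by rewrite mem_columns_below negb_and -leqNgt nj orbT.
  rewrite [LHS]marginal_eq0 => [|N NM]; last first.
    rewrite /K Hpos ?mule0// => Npos; apply: Mj.
    rewrite -(@theta_inv_local _ _ _ hE n.+1 N M) ?hE.1// => a b nb abE.
    by rewrite NM// mem_columns_below abE -leqNgt.
  rewrite marginal_eq0 ?mule0// => N NM; rewrite Hpos// => Npos; apply: Mj.
  by rewrite -NM.
pose i := Ordinal ltnp.
have colS : columns_below n.+1 = rcons (edges_to i) (i, i) ++ columns_below i.
  by rewrite /= insubT.
rewrite colS !marginal_cat.
rewrite (@eq_marginal _ _ _ _ _ (fun N => (jacobian_from E i (theta_inv E M))%:E *
    marginal (columns_below i) H (theta_inv E N))%E) => [|N NM]; last first.
  rewrite [LHS](IH N (ltnW ltnp)).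
  rewrite (@jacobian_from_local n (theta_inv E N) (theta_inv E M))//.
  apply: theta_inv_local => // a b nb abE; apply: NM.
  by rewrite mem_block abE -val_eqE/= gtn_eqF.
have jacS : jacobian_from E i (theta_inv E M) *
    `|\det (pa_cov E (theta_inv E M) i)| = jacobian_from E i.+1 (theta_inv E M).
  have pA : positive_form (pa_cov E (theta_inv E M) i) by exact: pa_cov_positive.
  rewrite jacobian_fromS mulrAC mulVf ?mul1r//.
  by rewrite normr_eq0 gt_eqF// positive_det.
rewrite marginal_block//.
- by rewrite jacS.
- by move=> N; exact: marginal_ge0.
- exact: measurable_marginal.
- exact: jacobian_from_ge0.
- by move=> N N' NN'; exact: marginal_local.
Qed.

End change_of_variables.

(** * The density of the incomplete covariance matrix *)

Section density.
Context (R : realType) (p : nat) (E : {set 'I_p * 'I_p}).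
Hypothesis hE : parent_ordered_dag E.
Implicit Types (U X : 'M[R]_p) (alpha : 'I_p -> R) (A : set (#|E|.-tuple R)).

Lemma dw_z_ge0 U alpha : 0 <= dw_z E U alpha.
Proof.
apply: prodr_ge0 => i _; rewrite !mulr_ge0 ?powR_ge0//.
by apply: Rintegral_ge0 => x _; rewrite mulr_ge0 ?powR_ge0 ?expR_ge0.
Qed.

Lemma dw_theta_density_ge0 U alpha DL : 0 <= dw_theta_density E U alpha DL.
Proof.
rewrite !mulr_ge0 ?invr_ge0 ?dw_z_ge0 ?expR_ge0//.
by apply: prodr_ge0 => i _; exact: powR_ge0.
Qed.

Lemma measurable_dw_theta_density d (T : measurableType d) U alpha
    (f : T -> 'M[R]_p) : measurable_fun setT f ->
  measurable_fun setT (fun x => dw_theta_density E U alpha (theta_of E (f x))).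
Proof.
move=> /(measurable_theta_of E)[mD mL]; apply: measurable_funM.
  apply: measurable_funM => //; apply: (measurableT_comp (@measurable_expR R)).
  apply: measurable_funM => //; apply: measurable_mxtrace.
  apply: measurable_mulmx => //; apply: measurable_mulmx.
    by apply: measurable_mulmx => //; exact: measurable_invmx.
  exact: measurable_trmx.
apply: measurable_prod => i _; apply: (measurableT_comp (@measurable_powR R _)).
exact: (proj1 (measurable_matrixP _) mD).
Qed.

Lemma measurable_jacobian_from d (T : measurableType d) n
    (f : T -> 'M[R]_p) : measurable_fun setT f ->
  measurable_fun setT (fun x => jacobian_from E n (f x)).
Proof.
move=> mf; rewrite /jacobian_from; under eq_fun do rewrite -big_filter.
apply: measurable_prod => i _; apply: measurable_funV.
apply: (measurableT_comp (@normr_measurable R setT)).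
exact/measurable_det/measurable_mxsub/measurable_cov.
Qed.

(** The density of (D, L), cut off to Theta_D and to the event that Sigma^E
    lies in [A]. *)
Definition theta_weight U alpha A X : \bar R :=
  ((fun X => (dw_theta_density E U alpha (theta_of E X))%:E) \_
     (@positive_diag R p `&` (fun X => incomplete E (cov E X)) @^-1` A)) X.

Lemma theta_weight_ge0 U alpha A X : (0 <= theta_weight U alpha A X)%E.
Proof.
by apply: erestrict_ge0 => Y _; rewrite lee_fin dw_theta_density_ge0.
Qed.

Lemma measurable_theta_weight U alpha A : measurable A ->
  measurable_fun setT (theta_weight U alpha A).
Proof.
move=> mA; apply/(measurable_restrictT _ _).1.
  apply: measurableI; first exact: measurable_positive_diag.
  rewrite -[X in measurable X]setTI.
  apply: (measurableT_comp (@measurable_incomplete R p E)) => //.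
  exact: measurable_cov.
apply: measurable_funTS; apply/measurable_EFinP.
exact: measurable_dw_theta_density.
Qed.

Lemma marginal_edges (F : 'M[R]_p -> \bar R) :
  (forall N, 0 <= F N)%E -> measurable_fun setT F ->
  (\int[lebesgue_tuple R #|E|]_t F (fill t) =
   marginal (columns_below E p) F 0)%E.
Proof.
move=> F0 mF.
rewrite (perm_marginal 0 (uniq_columns_below hE p) (perm_columns_below hE))//.
by rewrite (@marginal_lebesgue_tuple _ _ _ #|E|)// ?enum_uniq// -cardE.
Qed.

(** Both integrals run over the same entries; [marginal_change] for all the
    columns turns one into the other. *)
Lemma dw_S_integral U alpha A : measurable A ->
  (dw_S E U alpha A =
   \int[lebesgue_tuple R #|E|]_t
     ((jacobian_from E 0 (theta_inv E (fill t)))%:E *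
      theta_weight U alpha A (theta_inv E (fill t))))%E.
Proof.
move=> mA; have mH := measurable_theta_weight U alpha mA.
have H0 := theta_weight_ge0 U alpha A.
transitivity (\int[lebesgue_tuple R #|E|]_t theta_weight U alpha A (fill t))%E.
  rewrite /dw_S /pushforward /dw_theta integral_mkcond.
  apply: eq_integral => t _; rewrite /theta_weight !patchE theta_of_coordE.
  congr (if _ then _ else _); apply/idP/idP; rewrite !inE /=.
    by rewrite theta_of_coordE => -[? /(ThetaP hE)].
  by rewrite theta_of_coordE => -[/(ThetaP hE)].
pose K N : \bar R := ((jacobian_from E 0 (theta_inv E N))%:E *
  theta_weight U alpha A (theta_inv E N))%E.
rewrite (marginal_edges H0 mH) -[RHS]/(integral _ _ (fun t => K (fill t))).
rewrite (marginal_edges (F := K)); last 2 first.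
- by move=> N; rewrite /K mule_ge0// lee_fin jacobian_from_ge0.
- have mT := measurable_theta_inv E (@measurable_id _ 'M[R]_p setT).
  apply: emeasurable_funM; last exact: (measurableT_comp mH).
  exact/measurable_EFinP/measurable_jacobian_from.
rewrite /K marginal_change// => [|N Npos]; last first.
  by rewrite /theta_weight patchE memNset// => -[].
rewrite /jacobian_from big1 ?mul1e => [|i]; last by rewrite leqNgt ltn_ord.
apply: marginal_local => a b; rewrite mem_columns_below// ltn_ord andbT => abE.
by rewrite theta_inv_out// mxE.
Qed.

Lemma density_completion U alpha (t : #|E|.-tuple R) : S_D R E t ->
  (dw_z E U alpha)^-1
  * expR (- (1 / 2) * \tr (invmx (completion t) *m U))
  * \prod_(i < p)
      (\det (principal_submx (fa E i) (completion t)) `^ (- (1 / 2) * alpha i)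
       / \det (principal_submx (pa E i) (completion t))
           `^ (- (1 / 2) * alpha i + 1)) =
  dw_theta_density E U alpha (theta_of E (theta_inv E (fill t)))
  * jacobian_from E 0 (theta_inv E (fill t)).
Proof.
by move=> St; rewrite completionE// density_change//; apply/S_DP.
Qed.

End density.

Unset Implicit Arguments.

Theorem corollary5p6 (R : realType) (p : nat) (E : {set 'I_p * 'I_p})
    (hE : parent_ordered_dag E)
    (U : 'M[R]_p) (hU : posdefmx U)
    (alpha : 'I_p -> R) (halpha : forall i, #|pa E i|%:R + 2 < alpha i) :
  has_density (lebesgue_tuple R #|E|) (dw_S E U alpha) (S_D R E)
    (fun Gamma => let Sigma := completion Gamma in
       (dw_z E U alpha)^-1
       * expR (- (1 / 2) * \tr (invmx Sigma *m U))
       * \prod_(i < p)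
           (\det (principal_submx (fa E i) Sigma) `^ (- (1 / 2) * alpha i)
            / \det (principal_submx (pa E i) Sigma)
                `^ (- (1 / 2) * alpha i + 1)))
  /\
  (forall (d : measure_display) (T : measurableType d) (P : probability T R)
      (Sigma : {RV P >-> 'M[R]_p}),
    (forall w, PD E (Sigma w)) ->
    (forall B, measurable B -> distribution P Sigma B = dw_PD E U alpha B) ->
    let Gamma := fun w => incomplete E (Sigma w) in
    [/\ measurable_fun setT Gamma,
        forall w, completion (Gamma w) = Sigma w &
        forall B, measurable B -> pushforward P Gamma B = dw_S E U alpha B]).
Proof.
split; last first.
  move=> d T P Sigma PD_Sigma law_Sigma Gamma.
  split => [|w|B mB].
  - exact: (measurableT_comp (@measurable_incomplete R p E)).
  - exact: completion_incomplete.
  - rewrite -[LHS]/(distribution P Sigma (@incomplete R p E @^-1` B)).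
    rewrite law_Sigma// -[X in measurable X]setTI.
    exact: measurable_incomplete.
have mtheta : measurable_fun setT (fun t => theta_inv E (@fill R p E t)).
  by apply: measurable_theta_inv; exact: measurable_fill.
split => [||t _|A mA].
- exact: measurable_S_D.
- apply: (eq_measurable_fun (fun t : #|E|.-tuple R =>
      dw_theta_density E U alpha (theta_of E (theta_inv E (fill t)))
      * jacobian_from E 0 (theta_inv E (fill t)))).
    by move=> t /set_mem St; exact/esym/density_completion.
  apply: measurable_funTS; apply: measurable_funM.
    exact: measurable_dw_theta_density.
  exact: measurable_jacobian_from.
- rewrite !mulr_ge0 ?invr_ge0 ?dw_z_ge0 ?expR_ge0//.
  by apply: prodr_ge0 => i _; rewrite mulr_ge0 ?invr_ge0 ?powR_ge0.
- rewrite dw_S_integral// [RHS]integral_mkcond; apply: eq_integral => t _.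
  rewrite /theta_weight !patchE.
  case: ifPn => [/set_mem[tpos tA]|tn].
    have St : S_D R E t by apply/S_DP.
    move: tA; rewrite /= incomplete_cov_theta_inv// => tA.
    rewrite ifT; last by rewrite inE.
    by rewrite density_completion// -EFinM mulrC.
  rewrite mule0 ifF//; apply: contraNF tn => /set_mem[tA /(S_DP hE) tpos].
  by rewrite inE; split=> //=; rewrite incomplete_cov_theta_inv.
Qed.
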